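(* For every $N \ge 1$ let $E_N$ be a random sequence uniformly distributed on $\{-1,1\}^N$, and let $\mathcal{N}(E_N)$ denote its normality measure. Then there exists a probability distribution function $F:\mathbb{R}\to[0,1]$ such that for every $t \in \mathbb{R}$ $$\lim_{N \to \infty} \mathbb{P}\left( \frac{\mathcal{N}(E_N)}{\sqrt{N}} \leq t \right) = F(t),$$ and the function $F(t)$ is continuous for all $t \in \mathbb{R}$.
   Context: For a finite binary sequence $E_N = (e_1,\dots,e_N) \in \{-1,1\}^N$, and for positive integers $k, M$ and a pattern $X \in \{-1,1\}^k$, set $$T(E_N,M,X) = \#\left\{ n : 0 \le n < M \text{ and } (e_{n+1},\dots,e_{n+k}) = X \right\}$$ ($n$ ranging over integers). The normality measure of $E_N$ is $$\mathcal{N}(E_N) = \max_k \max_X \max_M \left| T(E_N,M,X) - \frac{M}{2^k} \right|,$$ where the maxima are taken over positive integers $k \le \log_2 N$, all $X \in \{-1,1\}^k$, and all integers $1 \le M \le N+1-k$. *)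

(* Defs.v *)
From HB Require Import structures.
From mathcomp Require Import all_boot all_order all_algebra.
From mathcomp Require Import all_classical all_reals all_analysis.
Set Implicit Arguments.
Unset Strict Implicit.
Unset Printing Implicit Defensive.
Import Order.TTheory GRing.Theory Num.Theory.
Import numFieldNormedType.Exports.
Local Open Scope classical_set_scope.
Local Open Scope ring_scope.

(* The two-element set {-1, 1}, as a finType. *)
Definition sign : finType := seq_sub [:: -1; 1 : int].

(* Sequences are indexed from 0, so e_{n+1}, ..., e_{n+k} are the k entries
   of E following its first n entries.  The window [take k (drop n E)] is
   shorter than k, hence different from X, as soon as n + k > N; this never
   happens for n < M <= N + 1 - k. *)
Definition pattern_count (N k : nat) (E : N.-tuple sign) (M : nat)
    (X : k.-tuple sign) : nat :=
  #|[pred n : 'I_M | take k (drop n E) == X :> seq sign]|.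

(* [trunc_log 2 N] is the integer part of log_2 N.  The maximized quantities
   are nonnegative, so the neutral element 0 only matters when the range of k
   is empty, that is for N < 2. *)
Definition normality_measure (R : realType) (N : nat) (E : N.-tuple sign) : R :=
  \big[Num.max/0]_(1 <= k < (trunc_log 2 N).+1)
    \big[Num.max/0]_(X : k.-tuple sign)
      \big[Num.max/0]_(1 <= M < (N + 1 - k).+1)
        `|(pattern_count E M X)%:R - M%:R / 2 ^+ k|.

(* E is a random element of the finite type S, measurable for the discrete
   sigma-algebra on S, whose law is the uniform distribution on S. *)
Definition uniformly_distributed (d : measure_display) (Omega : measurableType d)
    (R : realType) (P : probability Omega R) (S : finType) (E : Omega -> S) :=
  forall s : S, measurable (E @^-1` [set s]) /\
    P (E @^-1` [set s]) = ((#|S|%:R : R)^-1)%:E.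

(* Main.v *)
Require Import Defs.
From HB Require Import structures.
From mathcomp Require Import all_boot all_order all_algebra.
From mathcomp Require Import all_classical all_reals all_analysis.
From mathcomp Require Import ring lra zify.
Set Implicit Arguments.
Unset Strict Implicit.
Unset Printing Implicit Defensive.
Import Order.TTheory GRing.Theory Num.Theory.
Import numFieldNormedType.Exports.
Local Open Scope ring_scope.

(* The discrepancies T(E_N, M, X) - M / 2^k are sums of k-dependent centered
   indicators.  Splitting them into residue classes mod k turns them into
   Bernoulli walks, whose fourth moments give a maximal inequality; summed over
   all patterns it makes the patterns longer than a large constant K negligible
   at the scale sqrt N, and reduces the remaining ones to finitely many times.

   Existence of the limit: cut [0, N) into a fixed number P of blocks.  The
   block sums are independent and centered, with covariance asymptotically
   linear in the block length, so Lindeberg's replacement argument compares the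
   lengths N and N' directly, with an error O(P^(-1/2)) as N and N' go to
   infinity.  No Gaussian limit object is needed.

   Continuity: if the discrepancy of some pattern exceeds x before time N, then
   with high probability it gains a further c * sqrt(delta N) before time
   (1 + delta) N, whereas renormalizing by sqrt((1 + delta) N) only costs
   O(delta sqrt N).  Hence the distribution function at a point slightly above
   t, for the length (1 + delta) N, is at most the one at a point slightly below
   t, for the length N, up to a small error. *)

(** * Expectation on uniform sign sequences *)

(** A variance bound would not control long patterns: up to powers of [k] it gives a probability of
    order [2 ^- k] for each pattern, which the union bound over [2 ^ k] patterns cancels. The fourth
    moment gives [4 ^- k], provided that the pattern is expected at least once, that is
    [2 ^ k <= N]. The joint law of the discrepancies is degenerate in general, since the counts of
    different patterns satisfy linear relations. Continuity is therefore not drawn from a joint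
    density: it only uses that each single pattern has a variance of order [M]. The replacement
    argument never computes a covariance: divided by [N], the block covariances for two lengths are
    close to the same multiple of [1 / P], and the [P] blocks have third moments of order
    [P ^ (-3/2)] each. The continuity argument relates only two particular lengths. Comparing
    lengths extends it to all pairs of large lengths, and that single estimate yields both the
    convergence at every point and the continuity of the limit. *)

Lemma card_sign : #|{: sign}| = 2.
Proof. by rewrite card_seq_sub. Qed.

Section Expectation.
Variable R : realType.
Implicit Types (f g : seq sign -> R) (A B : seq sign -> Prop).

(** The recursion reads the first sign, so that conditioning on a prefix is a computation, and words
    of all lengths share the type [seq sign]. *)
Fixpoint Ex (n : nat) f : R :=
  if n is m.+1 then (\sum_(a : sign) Ex m (fun s => f (a :: s))) / 2 else f [::].

Lemma Ex_le n f g : (forall s, size s = n -> f s <= g s) -> Ex n f <= Ex n g.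
Proof.
elim: n f g => [|n IH] f g fg /=; first exact: fg.
rewrite ler_pM2r ?invr_gt0//; apply: ler_sum => a _.
by apply: IH => s sn; apply: fg; rewrite /= sn.
Qed.

Lemma eq_Ex n f g : (forall s, size s = n -> f s = g s) -> Ex n f = Ex n g.
Proof. by move=> fg; apply/le_anti/andP; split; apply: Ex_le => s /fg ->. Qed.

Lemma Ex_cst n c : Ex n (fun=> c) = c.
Proof.
elim: n => //= n IH; rewrite sumr_const card_sign IH -[c *+ 2]mulr_natr mulfK ?pnatr_eq0 //.
Qed.

Lemma ExD n f g : Ex n (fun s => f s + g s) = Ex n f + Ex n g.
Proof.
elim: n f g => //= n IH f g; rewrite -mulrDl -big_split/=.
by under eq_bigr do rewrite IH.
Qed.

Lemma ExZ n c f : Ex n (fun s => c * f s) = c * Ex n f.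
Proof.
elim: n f => //= n IH f; rewrite mulrA mulr_sumr.
by under eq_bigr do rewrite IH.
Qed.

Lemma ExZr n c f : Ex n (fun s => f s * c) = Ex n f * c.
Proof. by under eq_Ex do rewrite mulrC; rewrite ExZ mulrC. Qed.

Lemma ExN n f : Ex n (fun s => - f s) = - Ex n f.
Proof. by under eq_Ex do rewrite -mulN1r; rewrite ExZ mulN1r. Qed.

Lemma ExB n f g : Ex n (fun s => f s - g s) = Ex n f - Ex n g.
Proof. by rewrite ExD ExN. Qed.

Lemma Ex_sum (J : Type) (r : seq J) (Q : pred J) n (F : J -> seq sign -> R) :
  Ex n (fun s => \sum_(j <- r | Q j) F j s) = \sum_(j <- r | Q j) Ex n (F j).
Proof.
elim: r => [|j r IH]; first by under eq_Ex do rewrite big_nil; rewrite Ex_cst big_nil.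
under eq_Ex do rewrite big_cons; rewrite big_cons.
by case: (Q j) => //; rewrite ExD IH.
Qed.

Lemma Ex_ge0 n f : (forall s, size s = n -> 0 <= f s) -> 0 <= Ex n f.
Proof. by move=> f0; rewrite -[0](Ex_cst n) Ex_le. Qed.

Lemma ler_norm_Ex n f : `|Ex n f| <= Ex n (fun s => `|f s|).
Proof.
by rewrite ler_norml -ExN; apply/andP; split; apply: Ex_le => s _; rewrite ?ler_norm // lerNl -normrN ler_norm.
Qed.

Lemma Ex_cat m n f :
  Ex (m + n) f = Ex m (fun s => Ex n (fun t => f (s ++ t))).
Proof.
by elim: m f => //= m IH f; under eq_bigr do rewrite IH.
Qed.

Lemma Ex_split m n (F : seq sign -> seq sign -> R) : (m <= n)%N ->
  Ex n (fun s => F (take m s) (drop m s)) =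
  Ex m (fun s => Ex (n - m) (fun t => F s t)).
Proof.
move=> mn; rewrite -{1}(subnKC mn) Ex_cat.
apply: eq_Ex => s sm; apply: eq_Ex => t _.
by rewrite take_size_cat ?drop_size_cat.
Qed.

Lemma Ex_take m n f : (m <= n)%N -> Ex n (fun s => f (take m s)) = Ex m f.
Proof.
move=> mn; rewrite (Ex_split (fun s _ => f s)) //.
by apply: eq_Ex => s _; rewrite Ex_cst.
Qed.

Lemma Ex_drop m n f : (m <= n)%N -> Ex n (fun s => f (drop m s)) = Ex (n - m) f.
Proof. by move=> mn; rewrite (Ex_split (fun _ t => f t)) // Ex_cst. Qed.

Lemma Ex_indep m n f g : (m <= n)%N ->
  Ex n (fun s => f (take m s) * g (drop m s)) = Ex m f * Ex (n - m) g.
Proof.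
move=> mn; rewrite (Ex_split (fun s t => f s * g t)) // -ExZr.
by apply: eq_Ex => s _; rewrite ExZ.
Qed.

Lemma Ex_tuple n f : Ex n f = (\sum_(s : n.-tuple sign) f s) / 2 ^+ n.
Proof.
elim: n f => [|n IH] f /=.
  rewrite expr0 divr1 (bigD1 [tuple]) //= big1 ?addr0 // => s /eqP[].
  by rewrite (tuple0 s).
rewrite exprSr invfM mulrA; congr (_ / 2).
rewrite (reindex (fun p : sign * n.-tuple sign => cons_tuple p.1 p.2)) /=; last first.
  exists (fun s : n.+1.-tuple sign => (thead s, behead_tuple s)).
    by case=> a s _ /=; congr pair; apply: val_inj.
  by move=> s _; rewrite [RHS]tuple_eta; apply: val_inj.
rewrite -(pair_bigA _ (fun a (s : n.-tuple sign) => f (a :: s))) /= mulr_suml.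
by apply: eq_bigr => a _; rewrite IH.
Qed.

Definition Pr n A : R := Ex n (fun s => `[<A s>]%:R).

Lemma Pr_ge0 n A : 0 <= Pr n A.
Proof. by apply: Ex_ge0. Qed.

Lemma le_Pr n A B : (forall s, size s = n -> A s -> B s) -> Pr n A <= Pr n B.
Proof.
move=> AB; apply: Ex_le => s sn; rewrite ler_nat.
by case: (asboolP (A s)) => // As; rewrite asboolT //; exact: AB.
Qed.

Lemma Pr_le1 n A : Pr n A <= 1.
Proof. by rewrite -[1](Ex_cst n); apply: Ex_le => s _; rewrite lern1 leq_b1. Qed.

Lemma Pr_eq0 n A : (forall s, size s = n -> ~ A s) -> Pr n A = 0.
Proof.
move=> nA; rewrite -[0](Ex_cst n); apply: eq_Ex => s /nA As.
by rewrite asboolF.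
Qed.

Lemma PrC n A : Pr n (fun s => ~ A s) = 1 - Pr n A.
Proof.
rewrite -[1](Ex_cst n) -ExB; apply: eq_Ex => s _.
by rewrite asbool_neg; case: asboolP => _; rewrite ?subrr ?subr0.
Qed.

Lemma PrU n A B : Pr n (fun s => A s \/ B s) <= Pr n A + Pr n B.
Proof.
rewrite -ExD; apply: Ex_le => s _; rewrite asbool_or -natrD ler_nat.
by case: asboolP; case: asboolP.
Qed.

Lemma Pr_bigU (J : eqType) (r : seq J) n (A : J -> seq sign -> Prop) :
  Pr n (fun s => exists2 j, j \in r & A j s) <= \sum_(j <- r) Pr n (A j).
Proof.
rewrite -Ex_sum; apply: Ex_le => s _.
case: asboolP => [[j jr As]|_]; last exact: sumr_ge0.
by rewrite (big_rem j) //= asboolT // lerDl sumr_ge0.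
Qed.

Lemma Pr_take m n A : (m <= n)%N -> Pr n (fun s => A (take m s)) = Pr m A.
Proof. by move=> mn; rewrite /Pr (Ex_take (fun s => `[<A s>]%:R)). Qed.

Lemma Pr_drop m n A : (m <= n)%N -> Pr n (fun s => A (drop m s)) = Pr (n - m) A.
Proof. by move=> mn; rewrite /Pr (Ex_drop (fun s => `[<A s>]%:R)). Qed.

Lemma Pr_indep m n A B : (m <= n)%N ->
  Pr n (fun s => A (take m s) /\ B (drop m s)) = Pr m A * Pr (n - m) B.
Proof.
move=> mn; rewrite -(Ex_indep (fun s => `[<A s>]%:R) (fun s => `[<B s>]%:R)) //.
by apply: eq_Ex => s _; rewrite asbool_and -natrM mulnb.
Qed.

Lemma le_Pr_split m n A (B : seq sign -> seq sign -> Prop) : (m <= n)%N ->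
  (forall s t, size s = m -> size t = (n - m)%N -> A (s ++ t) -> B s t) ->
  Pr n A <= Ex m (fun s => Pr (n - m) (B s)).
Proof.
move=> mn AB; rewrite /Pr -{1}(subnKC mn) Ex_cat.
by apply: Ex_le => s sm; apply: le_Pr => t tn; exact: AB.
Qed.

End Expectation.

(** * Discrepancy of a pattern *)

Section Discrepancy.
Variable R : realType.
Implicit Types (X Y s t : seq sign).

Definition prob X : R := 2 ^- size X.

Definition occ X s : R := (take (size X) s == X)%:R - prob X.

(** A window cut by the end of [s] counts as a mismatch, so the centering is right only under
    [M + size X <= n.+1], a hypothesis that recurs throughout. *)
Definition disc X s (M : nat) : R := \sum_(i < M) occ X (drop i s).

Lemma prob_gt0 X : 0 < prob X. Proof. by rewrite invr_gt0 exprn_gt0. Qed.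

Lemma prob_le1 X : prob X <= 1.
Proof. by rewrite invf_le1 ?exprn_gt0 // exprn_ege1 // ler1n. Qed.

Hint Resolve prob_gt0 prob_le1 : core.

Lemma occ_take X s n : (size X <= n)%N -> occ X (take n s) = occ X s.
Proof. by move=> Xn; rewrite /occ take_takel. Qed.

Lemma occ_norm X s : `|occ X s| <= 1.
Proof.
have := prob_gt0 X; have := prob_le1 X; rewrite /occ ler_norml.
by case: (_ == _) => /= *; apply/andP; split; lra.
Qed.

Lemma Ex_match X n : (size X <= n)%N -> Ex n (fun s => (take (size X) s == X)%:R) = prob X.
Proof.
move=> Xn; rewrite (Ex_take (fun s => (s == X)%:R)) // {Xn n}.
rewrite /prob; elim: X => [|a X IH] /=; first by rewrite expr0 invr1.
rewrite exprSr invfM -IH; congr (_ / 2).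
rewrite (bigD1 a) //= big1 => [|b ba]; last first.
  by under eq_Ex do rewrite eqseq_cons (negbTE ba); rewrite Ex_cst.
by rewrite addr0; apply: eq_Ex => s _; rewrite eqseq_cons eqxx.
Qed.

Lemma Ex_occ_fun X n (f : R -> R) : (size X <= n)%N ->
  Ex n (fun s => f (occ X s)) =
  prob X * f (1 - prob X) + (1 - prob X) * f (- prob X).
Proof.
move=> Xn; under eq_Ex => s _.
  rewrite (_ : f _ = f (- prob X) + (take (size X) s == X)%:R * (f (1 - prob X) - f (- prob X))); last first.
    by rewrite /occ; case: (_ == _) => /=; rewrite ?mul1r ?mul0r ?sub0r; ring.
  over.
by rewrite ExD ExZr Ex_match // Ex_cst; ring.
Qed.

Lemma Ex_occ X n : (size X <= n)%N -> Ex n (occ X) = 0.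
Proof. by move=> Xn; rewrite (Ex_occ_fun (fun x => x)) //; ring. Qed.

Lemma disc0 X s : disc X s 0 = 0. Proof. by rewrite /disc big_ord0. Qed.

Lemma disc_nil s M : disc [::] s M = 0.
Proof.
by rewrite /disc big1 // => i _; rewrite /occ /prob take0 eqxx expr0 invr1 subrr.
Qed.

Lemma discD X s M N : disc X s (M + N) = disc X s M + disc X (drop M s) N.
Proof.
rewrite /disc big_split_ord /=; congr (_ + _).
by apply: eq_bigr => i _; rewrite drop_drop addnC.
Qed.

Lemma disc1 X s : disc X s 1 = occ X s.
Proof. by rewrite /disc big_ord1 drop0. Qed.

Lemma discS X s M : disc X s M.+1 = occ X s + disc X (drop 1 s) M.
Proof. by rewrite -add1n discD disc1. Qed.

Lemma disc_take X s n M : (M + size X <= n.+1)%N ->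
  disc X (take n s) M = disc X s M.
Proof.
move=> MX; apply: eq_bigr => i _; have iM := ltn_ord i.
have -> : drop i (take n s) = take (n - i) (drop i s).
  by rewrite take_drop subnK //; lia.
by rewrite occ_take //; lia.
Qed.

Lemma ler_norm_disc X s M : `|disc X s M| <= M%:R.
Proof.
rewrite (le_trans (ler_norm_sum _ _ _)) //.
rewrite (le_trans (ler_sum _ (fun i _ => occ_norm _ _))) //.
by rewrite sumr_const card_ord.
Qed.

Lemma Ex_disc X n M : (M + size X <= n.+1)%N -> Ex n (disc X ^~ M) = 0.
Proof.
move=> MX; rewrite Ex_sum big1 // => i _; have iM := ltn_ord i.
by rewrite (Ex_drop (occ X)) ?Ex_occ //; lia.
Qed.

(* The occurrences of X at the positions 0, k, 2k, ..., with k = size X: these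
   lie in disjoint windows, hence are independent. *)
Definition disc_blocks X s (J : nat) : R :=
  \sum_(j < J) occ X (drop (j * size X) s).

Lemma disc_blocksS X s J :
  disc_blocks X s J.+1 = occ X s + disc_blocks X (drop (size X) s) J.
Proof.
rewrite /disc_blocks big_ord_recl /= mul0n drop0; congr (_ + _).
by apply: eq_bigr => i _; rewrite drop_drop /bump /= mulSn addnC.
Qed.

(** [J r] is the number of positions below [M] congruent to [r]; the bound on [J r * size X + r]
    places the last of them below [M]. In the induction on [M %/ k], the first [k] positions
    contribute one term to each class. *)
Lemma disc_residues X M : (0 < size X)%N ->
  exists J : nat -> nat,
    (forall r, (r < size X)%N -> (J r * size X + r < M + size X)%N /\ (J r <= M)%N) /\
    forall s, disc X s M = \sum_(r < size X) disc_blocks X (drop r s) (J r).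
Proof.
set k := size X => k0; rewrite (divn_eq M k).
elim: (M %/ k)%N => [|q [J [JM DJ]]].
  rewrite mul0n add0n; exists (fun r => (r < M %% k)%N); split=> [r rk|s].
    by case: ltnP => /=; lia.
  have Mk : (M %% k <= k)%N by rewrite ltnW // ltn_mod.
  rewrite [LHS](big_ord_widen_cond _ xpredT (fun i => occ X (drop i s)) Mk) /=.
  rewrite big_mkcond /=; apply: eq_bigr => r _; rewrite /disc_blocks.
  by case: ltnP => _; rewrite ?big_ord1 ?big_ord0 // mul0n drop0.
exists (fun r => (J r).+1); split=> [r rk|s].
  by have [] := JM r rk; rewrite !mulSn; lia.
rewrite mulSn -addnA discD DJ /disc -big_split /=.
by apply: eq_bigr => r _; rewrite disc_blocksS !drop_drop addnC.
Qed.

(* Majorant of the fourth moment of y plus a sum of m independent centered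
   Bernoulli variables of parameter p. *)
Definition quartic (p y : R) (m : nat) : R :=
  y ^+ 4 + 8 * m%:R * p * y ^+ 2 + 3 * p * m%:R + 4 * p ^+ 2 * m%:R ^+ 2.

Lemma quartic_ge p y m : 0 <= p -> y ^+ 4 <= quartic p y m.
Proof.
move=> p0; rewrite /quartic -!addrA lerDl.
have := sqr_ge0 y; have := sqr_ge0 p; have := sqr_ge0 (m%:R : R).
move: (y ^+ 2) (p ^+ 2) (_ ^+ 2) => u v w w0 v0 u0.
by rewrite !addr_ge0 ?mulr_ge0.
Qed.

Lemma quartic_ge0 p y m : 0 <= p -> 0 <= quartic p y m.
Proof.
by move=> p0; apply: le_trans (quartic_ge y m p0); rewrite exprn_even_ge0.
Qed.

Lemma quartic_gt p y m mu : 0 <= p -> 0 < mu -> mu < `|y| -> mu ^+ 4 <= quartic p y m.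
Proof.
move=> p0 mu0 y_gt; apply: le_trans (quartic_ge y m p0).
rewrite -[y ^+ 4]ger0_norm ?exprn_even_ge0 // normrX.
by rewrite lerXn2r ?nnegrE ?normr_ge0 ?(ltW mu0) ?(ltW y_gt).
Qed.

(** This is the supermartingale property of [quartic]. The variance alone would require the
    coefficient 6 for [y ^ 2]; with 8, the surplus completes a square with the odd term
    [4 * u * (1 - 2 * p) * y] coming from the third moment. *)
Lemma quartic_step p y m : 0 <= p -> p <= 1 ->
  p * quartic p (y + (1 - p)) m + (1 - p) * quartic p (y + - p) m
  <= quartic p y m.+1.
Proof.
move=> p0 p1; rewrite /quartic -addn1 natrD.
set n : R := m%:R; have n0 : 0 <= n by rewrite /n.
set u := p * (1 - p); have u0 : 0 <= u by rewrite mulr_ge0 // subr_ge0.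
have up : u <= p by rewrite /u ler_piMr // lerBlDr lerDl.
rewrite -subr_ge0.
rewrite [leRHS](_ : _
  = 8 * (p - u) * y ^+ 2 + 2 * u * (y - (1 - 2 * p)) ^+ 2 + 3 * (p - u)
    + 11 * u ^+ 2 + 8 * n * p * (p - u) + 4 * p ^+ 2); last by rewrite /u; ring.
have pu : 0 <= p - u by rewrite subr_ge0.
have := sqr_ge0 y; have := sqr_ge0 (y - (1 - 2 * p)); have := sqr_ge0 u.
have := sqr_ge0 p; clearbody u.
move: (p ^+ 2) (u ^+ 2) ((y - (1 - 2 * p)) ^+ 2) (y ^+ 2) => p2 u2 v2 y2 *.
by rewrite !addr_ge0 ?mulr_ge0.
Qed.

Lemma Ex_quartic X y m n : (size X <= n)%N ->
  Ex n (fun s => quartic (prob X) (y + occ X s) m) <= quartic (prob X) y m.+1.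
Proof.
move=> Xn; rewrite (Ex_occ_fun (fun x => quartic (prob X) (y + x) m)) //.
by apply: quartic_step => //; exact: ltW.
Qed.

(** Doob's maximal inequality for the supermartingale [quartic], by recursion on the time left. If
    [mu < |y|] the bound exceeds 1 and nothing is to be proved; otherwise the event needs one more
    step, and [Ex_quartic] averages the bound. The starting value [y] carries the past of the
    walk. *)
Lemma Pr_disc_blocks X n m y mu : 0 < mu ->
  Pr R n (fun s => exists J, [/\ (J <= m)%N, (J * size X <= n)%N &
                   mu < `|y + disc_blocks X s J|])
  <= quartic (prob X) y m / mu ^+ 4.
Proof.
move=> mu0; have p0 := ltW (prob_gt0 X).
elim: m n y => [|m IH] n y; have [y_le|y_gt] := leP `|y| mu.
- rewrite Pr_eq0; last first.
    move=> s _ [J []]; rewrite leqn0 => /eqP -> _.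
    by rewrite /disc_blocks big_ord0 addr0 ltNge y_le.
  by rewrite divr_ge0 ?quartic_ge0 ?exprn_ge0 // ltW.
- rewrite (le_trans (Pr_le1 _ _ _)) // ler_pdivlMr ?exprn_gt0 // mul1r.
  exact: quartic_gt.
- have q0 : 0 <= quartic (prob X) y m.+1 / mu ^+ 4.
    by rewrite divr_ge0 ?quartic_ge0 ?exprn_ge0 // ltW.
  have [nX|Xn] := ltnP n (size X).
    rewrite Pr_eq0 // => s _ [[|J] [_ JX]]; last by lia.
    by rewrite /disc_blocks big_ord0 addr0 ltNge y_le.
  apply: (@le_trans _ _ (Ex (size X) (fun s => Pr R (n - size X) (fun t =>
    exists J, [/\ (J <= m)%N, (J * size X <= n - size X)%N &
                   mu < `|y + occ X s + disc_blocks X t J|])))).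
    apply: le_Pr_split => // s t sX _ [[|J] [Jm JX]].
      by rewrite /disc_blocks big_ord0 addr0 ltNge y_le.
    rewrite disc_blocksS drop_size_cat // -(occ_take _ (leqnn _)) take_size_cat // addrA => ?.
    by exists J; split => //; lia.
  apply: (@le_trans _ _ (Ex (size X) (fun s => quartic (prob X) (y + occ X s) m / mu ^+ 4))).
    by apply: Ex_le => s _; exact: IH.
  by rewrite ExZr ler_pM2r ?invr_gt0 ?exprn_gt0 // Ex_quartic.
- rewrite (le_trans (Pr_le1 _ _ _)) // ler_pdivlMr ?exprn_gt0 // mul1r.
  exact: quartic_gt.
Qed.

End Discrepancy.

(** * Tail estimates *)

Section Tails.
Variable R : realType.
Implicit Types (X Y s t : seq sign).
Local Notation disc := (disc R).
Local Notation disc_blocks := (disc_blocks R).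
Local Notation prob := (prob R).
Local Notation Pr := (Pr R).

Lemma norm_sum_pigeonhole k (x : 'I_k -> R) : (0 < k)%N ->
  exists r, `|\sum_(i < k) x i| <= k%:R * `|x r|.
Proof.
case: k x => // k x _.
have [r _ xr] := @Order.TotalTheory.arg_maxP _ _ _ ord0 xpredT (fun i => `|x i|) isT.
exists r; rewrite (le_trans (ler_norm_sum _ _ _)) //.
rewrite (le_trans (ler_sum _ (fun i _ => xr i isT))) //.
by rewrite sumr_const card_ord mulr_natl.
Qed.

Lemma quartic_homo p (m n : nat) : 0 <= p -> (m <= n)%N -> quartic p 0 m <= quartic p (0 : R) n.
Proof.
move=> p0 mn; rewrite /quartic !expr0n /= !mulr0 !add0r.
have mn' : m%:R <= n%:R :> R by rewrite ler_nat.
by rewrite lerD // ler_wpM2l ?mulr_ge0 ?exprn_ge0 // lerXn2r ?nnegrE.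
Qed.

Lemma Ex_disc_blocks4 X n J y : (J * size X <= n)%N ->
  Ex n (fun s => (y + disc_blocks X s J) ^+ 4) <= quartic (prob X) y J.
Proof.
elim: J n y => [|J IH] n y JX.
  under eq_Ex do rewrite /disc_blocks big_ord0 addr0.
  by rewrite Ex_cst quartic_ge // ltW // prob_gt0.
have Xn : (size X <= n)%N by lia.
under eq_Ex => s _ do rewrite disc_blocksS addrA -(occ_take _ _ (leqnn _)).
rewrite (Ex_split (fun s t => (y + occ R X s + disc_blocks X t J) ^+ 4)) //.
apply: le_trans (Ex_quartic y J (leqnn (size X))).
by apply: Ex_le => s _; apply: IH; lia.
Qed.

(** The largest of the [k] residue classes is at least [1 / k] of the total, whence [k ^ 4];
    replacing the largest fourth power by the sum of all of them costs one more [k]. *)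
Lemma Ex_disc4 X n M : (M + size X <= n.+1)%N ->
  Ex n (fun s => disc X s M ^+ 4) <= (size X)%:R ^+ 5 * quartic (prob X) 0 M.
Proof.
move=> MX; have p0 := ltW (prob_gt0 R X).
have [X0|k0] := posnP (size X).
  rewrite X0 expr0n mul0r (size0nil X0).
  under eq_Ex do rewrite disc_nil expr0n.
  by rewrite Ex_cst.
have [J [JM DJ]] := disc_residues R M k0.
set k := size X in MX k0 JM DJ *.
apply: (@le_trans _ _ (Ex n (fun s => k%:R ^+ 4 * \sum_(r < k) (disc_blocks X (drop r s) (J r)) ^+ 4))).
  apply: Ex_le => s _; rewrite DJ.
  have [r xr] := norm_sum_pigeonhole (fun r : 'I_k => disc_blocks X (drop r s) (J r)) k0.
  apply: (@le_trans _ _ (k%:R ^+ 4 * (disc_blocks X (drop r s) (J r)) ^+ 4)); last first.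
    rewrite ler_wpM2l ?exprn_ge0 // (bigD1 r) //= lerDl sumr_ge0 // => i _.
    by rewrite exprn_even_ge0.
  rewrite -exprMn -[leLHS]ger0_norm ?exprn_even_ge0 // -[leRHS]ger0_norm ?exprn_even_ge0 //.
  by rewrite !normrX lerXn2r ?nnegrE // normrM normr_nat.
rewrite ExZ Ex_sum [_ ^+ 5]exprSr -mulrA ler_wpM2l ?exprn_ge0 //.
rewrite -[k in k%:R * _]card_ord mulr_natl -sumr_const; apply: ler_sum => r _.
have [Jr JrM] := JM r (ltn_ord r); have rk := ltn_ord r.
rewrite (Ex_drop (fun s => disc_blocks X s (J r) ^+ 4)); last by lia.
under eq_Ex do rewrite -[disc_blocks _ _ _]add0r.
apply: le_trans (quartic_homo p0 JrM).
by apply: Ex_disc_blocks4; rewrite -/k; lia.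
Qed.

(** The maximal inequality is applied in each residue class at level [lam / k]: the level gives
    [k ^ 4], the union bound over the classes one more [k]. *)
Lemma Pr_disc X n m lam : 0 < lam ->
  Pr n (fun s => exists M, [/\ (M <= m)%N, (M + size X <= n.+1)%N & lam < `|disc X s M|])
  <= (size X)%:R ^+ 5 * quartic (prob X) 0 m / lam ^+ 4.
Proof.
move=> lam0; have p0 := ltW (prob_gt0 R X).
have B0 : 0 <= (size X)%:R ^+ 5 * quartic (prob X) 0 m / lam ^+ 4.
  by rewrite !mulr_ge0 ?invr_ge0 ?exprn_ge0 ?quartic_ge0 // ltW.
have [X0|k0] := posnP (size X).
  rewrite Pr_eq0 // => s _ [M [_ _]].
  by rewrite (size0nil X0) disc_nil normr0 ltNge ltW.
set k := size X in B0 k0 *.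
have [kn|nk] := leqP k n; last first.
  rewrite Pr_eq0 // => s _ [M [_ Mk]].
  by have -> : M = 0%N by [lia]; rewrite disc0 normr0 ltNge ltW.
have kR : 0 < k%:R :> R by rewrite ltr0n.
apply: (@le_trans _ _ (Pr n (fun s => exists2 r : 'I_k, r \in index_enum 'I_k &
  exists J, [/\ (J <= m)%N, (J * k <= n - r)%N & lam / k%:R < `|0 + disc_blocks X (drop r s) J|]))).
  apply: le_Pr => s _ [M [Mm Mn lamD]].
  have [J [JM DJ]] := disc_residues R M k0.
  have [r xr] := norm_sum_pigeonhole (fun r : 'I_k => disc_blocks X (drop r s) (J r)) k0.
  have [Jr JrM] := JM r (ltn_ord r); have rk := ltn_ord r.
  exists r; first exact: mem_index_enum.
  exists (J r); split; rewrite -/k in Jr *; [lia|lia|].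
  by rewrite ltr_pdivrMr // add0r mulrC (lt_le_trans lamD) // DJ.
apply: le_trans (Pr_bigU _ _ _ _) _.
apply: (@le_trans _ _ (\sum_(r < k) quartic (prob X) 0 m / (lam / k%:R) ^+ 4)).
  apply: ler_sum => r _; have rk := ltn_ord r.
  rewrite (Pr_drop R (fun s => exists J, [/\ (J <= m)%N, (J * k <= n - r)%N &
    lam / k%:R < `|0 + disc_blocks X s J|])); last by lia.
  by apply: Pr_disc_blocks; rewrite divr_gt0.
rewrite sumr_const card_ord -[_ *+ k]mulr_natl le_eqVlt; apply/orP; left; apply/eqP.
by field; rewrite !lt0r_neq0.
Qed.

Lemma pow5_exp : exists2 C : R, 0 <= C & forall k : nat, k%:R ^+ 5 / 2 ^+ k <= C * (3 / 4) ^+ k.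
Proof.
(* The increment [25 / 2 * (2 / 25) = 1] drives the linear bound below, and [(27 / 25) ^ 5 <= 3 / 2]
   turns the factor [2 ^- k] into [(3 / 4) ^ k]. *)
exists ((25 / 2) ^+ 5); first by rewrite exprn_ge0 //; lra.
have k_le (k : nat) : k%:R <= 25 / 2 * (27 / 25) ^+ k :> R.
  elim: k => [|k IH]; first by rewrite expr0; lra.
  have : 1 <= (27 / 25) ^+ k :> R by rewrite exprn_ege1 //; lra.
  by rewrite -[k.+1%:R]natr1 exprS; lra.
move=> k; rewrite ler_pdivrMr ?exprn_gt0 // -mulrA -exprMn.
apply: le_trans (_ : (25 / 2 * (27 / 25) ^+ k) ^+ 5 <= _).
  by rewrite lerXn2r ?nnegrE // mulr_ge0 ?exprn_ge0 //; lra.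
rewrite [leLHS]exprMn ler_wpM2l ?exprn_ge0 //.
by rewrite exprAC lerXn2r ?nnegrE ?exprn_ge0 //; lra.
Qed.

Lemma sum_geo34 K n : \sum_(k <- iota K n) (3 / 4) ^+ k <= 4 * (3 / 4) ^+ K :> R.
Proof.
elim: n K => [|n IH] K; first by rewrite big_nil mulr_ge0 // exprn_ge0 //; lra.
rewrite big_cons; apply: le_trans (_ : (3 / 4) ^+ K + 4 * (3 / 4) ^+ K.+1 <= _); first by rewrite lerD2l.
by rewrite exprS; lra.
Qed.

Lemma Pr_long_patterns : exists2 C : R, 0 <= C & forall (e : R) K N, 0 < e -> (0 < N)%N ->
  Pr N (fun s => exists X M, [/\ (K < size X)%N, (2 ^ size X <= N)%N, (M + size X <= N.+1)%N &
                    e * Num.sqrt N%:R < `|disc X s M|])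
  <= C / e ^+ 4 * (3 / 4) ^+ K.
Proof.
(* [28 = 7 * 4]: the coefficients [3 + 4] of [quartic], times the factor of the geometric series. *)
have [C C0 HC] := pow5_exp; exists (28 * C) => [|e K N e0 N0]; first by rewrite mulr_ge0.
have NR : 0 < N%:R :> R by rewrite ltr0n.
have sN : 0 < e * Num.sqrt N%:R by rewrite mulr_gt0 ?sqrtr_gt0.
have Ce : 0 <= C / e ^+ 4 by rewrite divr_ge0 // exprn_ge0 // ltW.
have q0 k : 0 <= (3 / 4) ^+ k :> R by rewrite exprn_ge0 //; lra.
pose A X s := exists M, [/\ (M <= N)%N, (M + size X <= N.+1)%N &
                    e * Num.sqrt N%:R < `|disc X s M|].
apply: (@le_trans _ _ (Pr N (fun s => exists2 k, k \in [seq k <- iota K.+1 N | (2 ^ k <= N)%N] &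
   exists2 X : k.-tuple sign, X \in index_enum _ & A X s))).
  apply: le_Pr => s _ [X [M [KX XN MX HX]]].
  exists (size X).
    rewrite mem_filter XN mem_iota KX /=.
    by rewrite (leq_trans (leq_trans (ltn_expl (size X) (ltnSn 1)) XN)) // leq_addl.
  exists (in_tuple X); first exact: mem_index_enum.
  exists M; split => //=.
  have [X0|] := posnP (size X); last by lia.
  by move: HX; rewrite (size0nil X0) disc_nil normr0 ltNge ltW.
apply: le_trans (Pr_bigU _ _ _ _) _; rewrite big_filter.
apply: (@le_trans _ _ (\sum_(k <- iota K.+1 N | (2 ^ k <= N)%N) 7 * C / e ^+ 4 * (3 / 4) ^+ k)).
  apply: ler_sum => k kN; apply: le_trans (Pr_bigU _ _ _ _) _.
  have pk : 2 ^+ k <= N%:R :> R by rewrite -natrX ler_nat.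
  have k2 : 0 < 2 ^+ k :> R by rewrite exprn_gt0.
  apply: (@le_trans _ _ (\sum_(X : k.-tuple sign) 7 * k%:R ^+ 5 * (2 ^- k) ^+ 2 / e ^+ 4)).
    apply: ler_sum => X _; apply: le_trans (Pr_disc _ _ _ sN) _.
    rewrite size_tuple /prob size_tuple /quartic !expr0n /= !mulr0 !add0r exprMn.
    have -> : Num.sqrt N%:R ^+ 4 = N%:R ^+ 2 :> R by rewrite (exprM _ 2 2) sqr_sqrtr.
    rewrite ler_pdivrMr ?mulr_gt0 ?exprn_gt0 //.
    rewrite [leRHS](_ : _ = k%:R ^+ 5 * (7 * (2 ^- k) ^+ 2 * N%:R ^+ 2)); last first.
      by field; rewrite ?lt0r_neq0.
    rewrite ler_wpM2l ?exprn_ge0 //.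
    (* The number of occurrences expected in length [N] is at least 1, so the quadratic term of the
       fourth moment dominates the linear one. *)
    have : 1 <= 2 ^- k * N%:R :> R by rewrite ler_pdivlMl // mulr1.
    set x := 2 ^- k * N%:R => x1.
    have -> : 3 * 2 ^- k * N%:R + 4 * (2 ^- k) ^+ 2 * N%:R ^+ 2 = 3 * x + 4 * x ^+ 2.
      by rewrite /x; ring.
    have -> : 7 * (2 ^- k) ^+ 2 * N%:R ^+ 2 = 7 * x ^+ 2 by rewrite /x; ring.
    by nra.
  (* The [2 ^ k] patterns cancel only one of the two factors [2 ^- k]; the other one beats
     [k ^ 5]. *)
  rewrite sumr_const card_tuple card_sign -[leLHS]mulr_natr natrX.
  have := HC k; rewrite -(ler_pM2l (_ : 0 < 7 / e ^+ 4)); last by rewrite divr_gt0 ?exprn_gt0.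
  rewrite [X in _ <= X -> _](_ : _ = 7 * C / e ^+ 4 * (3 / 4) ^+ k); last by ring.
  apply: le_trans; rewrite le_eqVlt; apply/orP; left; apply/eqP.
  by field; rewrite ?lt0r_neq0 ?exprn_gt0.
apply: (@le_trans _ _ (\sum_(k <- iota K.+1 N) 7 * C / e ^+ 4 * (3 / 4) ^+ k)).
  rewrite [leRHS](bigID (fun k => 2 ^ k <= N)%N) /= lerDl sumr_ge0 // => k _.
  by rewrite -[7 * C / _]mulrA mulr_ge0 ?q0 // mulr_ge0.
rewrite -mulr_sumr; apply: (@le_trans _ _ (7 * C / e ^+ 4 * (4 * (3 / 4) ^+ K.+1))).
  by rewrite ler_wpM2l ?sum_geo34 // -[7 * C / _]mulrA mulr_ge0.
rewrite -[7 * C / _]mulrA -[28 * C / _]mulrA [_ ^+ K.+1]exprS.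
move: (C / _) ((3 / 4) ^+ K) Ce (q0 K) => x y x0 y0.
by have := mulr_ge0 x0 y0; lra.
Qed.

End Tails.

(** * Moments of the discrepancy *)

Section Moments.
Variable R : realType.
Implicit Types (X Y s t : seq sign).
Local Notation disc := (disc R).
Local Notation occ := (occ R).
Local Notation prob := (prob R).
Local Notation Pr := (Pr R).

(** At lags beyond [K] the windows are disjoint, hence independent and centered, so only the first
    [K] lags contribute. *)
Lemma Ex_occ_disc X Y K M n : (size X <= K)%N -> (size Y <= K)%N -> (K <= M)%N ->
  (M + K < n)%N ->
  Ex n (fun s => occ X s * disc Y (drop 1 s) M) =
  Ex (K + K).+1 (fun s => occ X s * disc Y (drop 1 s) K).
Proof.
move=> XK YK KM Mn.
have -> : Ex n (fun s => occ X s * disc Y (drop 1 s) M) =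
  Ex n (fun s => occ X s * disc Y (drop 1 s) K) +
  Ex n (fun s => occ X (take K.+1 s) * disc Y (drop K.+1 s) (M - K)).
  rewrite -ExD; apply: eq_Ex => s _; rewrite -{1}(subnKC KM) discD drop_drop addn1.
  by rewrite occ_take ?mulrDr //; lia.
rewrite (Ex_indep (occ X) (disc Y ^~ (M - K)%N)); last by lia.
rewrite Ex_occ ?mul0r ?addr0; last by lia.
rewrite -(Ex_take (fun s => occ X s * disc Y (drop 1 s) K) (_ : (K + K).+1 <= n)%N); last by lia.
apply: eq_Ex => s _; rewrite occ_take; last by lia.
rewrite -(subnK (_ : 1 <= (K + K).+1)%N) // -take_drop disc_take //; lia.
Qed.

(** Removing the first position changes the covariance by the correlations of one window with all
    later ones. By [Ex_occ_disc] this increment, [gam], no longer depends on [M] once [K <= M]: from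
    there on the covariance is affine in [M]. *)
Lemma disc_covariance X Y K : (size X <= K)%N -> (size Y <= K)%N ->
  exists gam beta : R, 0 <= beta /\ forall M n, (K <= M)%N -> (M + K <= n)%N ->
    `|Ex n (fun s => disc X s M * disc Y s M) - gam * M%:R| <= beta.
Proof.
move=> XK YK.
pose a M := Ex (M + K) (fun s => disc X s M * disc Y s M).
have aE M n : (M + K <= n)%N -> Ex n (fun s => disc X s M * disc Y s M) = a M.
  move=> Mn; rewrite /a -(Ex_take _ Mn); apply: eq_Ex => s _.
  by rewrite !disc_take //; lia.
pose gam := Ex K.+1 (fun s => occ X s * occ Y s) +
  Ex (K + K).+1 (fun s => occ X s * disc Y (drop 1 s) K) +
  Ex (K + K).+1 (fun s => occ Y s * disc X (drop 1 s) K).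
have aS M : (K <= M)%N -> a M.+1 = a M + gam.
  move=> KM; rewrite /gam -(Ex_occ_disc (M := M) (n := (M.+1 + K)%N) XK YK) //.
  rewrite -(Ex_occ_disc (M := M) (n := (M.+1 + K)%N) YK XK) //.
  rewrite -(Ex_take (fun s => occ X s * occ Y s) (_ : K.+1 <= M.+1 + K)%N); last by lia.
  rewrite -(aE M (M.+1 + K - 1)%N); last by lia.
  rewrite -(Ex_drop (fun s => disc X s M * disc Y s M)); last by lia.
  rewrite /a -!ExD; apply: eq_Ex => s _; rewrite !discS !occ_take; try lia.
  by ring.
exists gam, `|a K - gam * K%:R|; split=> // M n KM /aE ->.
suff -> : a M - gam * M%:R = a K - gam * K%:R by [].
elim: M KM => [|M IH]; first by rewrite leqn0 => /eqP ->.
rewrite leq_eqVlt => /orP[/eqP <- //|KM].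
by rewrite aS // -(IH KM) -[M.+1%:R]natr1; ring.
Qed.

Lemma sum_ltn (c M : nat) : \sum_(i < M) (i < c)%:R <= c%:R :> R.
Proof.
rewrite -natr_sum ler_nat; suff -> : (\sum_(i < M) (i < c) = minn M c)%N by rewrite geq_minr.
by elim: M => [|M IH]; rewrite ?big_ord0 ?big_ord_recr /= ?IH; lia.
Qed.

Lemma Ex_occ_occ X h n : (0 < h)%N -> (h + size X <= n)%N ->
  - (h < size X)%:R * prob X ^+ 2 <= Ex n (fun s => occ X s * occ X (drop h s)).
Proof.
move=> h0 hn; have [hX|Xh] := ltnP h (size X).
  pose m s : R := (take (size X) s == X)%:R.
  have mE : Ex n (fun s => m (drop h s)) = prob X.
    by rewrite (Ex_drop m) ?Ex_match //; lia.
  have m0 : Ex n m = prob X by rewrite Ex_match //; lia.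
  have -> : Ex n (fun s => occ X s * occ X (drop h s)) =
            Ex n (fun s => m s * m (drop h s)) - prob X ^+ 2.
    transitivity (Ex n (fun s => m s * m (drop h s) +
      (- prob X * m s + (- prob X * m (drop h s) + prob X ^+ 2)))).
      by apply: eq_Ex => s _; rewrite /occ /m; ring.
    by rewrite !ExD !ExZ Ex_cst mE m0; ring.
  by rewrite mulN1r lerBrDl subrr Ex_ge0 // => s _; rewrite /m -natrM ler0n.
rewrite mulNr mul0r oppr0.
under eq_Ex => s _ do rewrite -(occ_take _ _ Xh).
by rewrite (Ex_indep (occ X) (occ X)) ?Ex_occ ?mul0r //; lia.
Qed.

(* Overlapping windows have covariance at least - prob X ^+ 2, and there are
   2 (k - 1) of them, which is less than 2 ^ k - 1. *)
Lemma Ex_disc2_ge X M n : (M + size X <= n.+1)%N -> (0 < size X)%N ->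
  M%:R * (prob X * (1 - (2 * (size X)%:R - 1) * prob X)) <= Ex n (fun s => disc X s M ^+ 2).
Proof.
move=> + X0; elim: M n => [|M IH] n Mn.
  by rewrite mul0r Ex_ge0 // => s _; rewrite sqr_ge0.
have -> : Ex n (fun s => disc X s M.+1 ^+ 2) = Ex n (fun s => occ X s ^+ 2)
  + 2 * (\sum_(i < M) Ex n (fun s => occ X s * occ X (drop i.+1 s)))
  + Ex (n - 1) (fun s => disc X s M ^+ 2).
  rewrite -(Ex_drop (fun s => disc X s M ^+ 2)); last by lia.
  rewrite -Ex_sum -ExZ -!ExD; apply: eq_Ex => s _.
  rewrite discS sqrrD -mulr_sumr /disc; congr (_ + _ + _); rewrite mulr_natl; congr (_ * _ *+ 2).
  by apply: eq_bigr => i _; rewrite drop_drop addn1.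
rewrite (Ex_occ_fun (fun x => x ^+ 2)); last by lia.
have : - ((size X)%:R - 1) * prob X ^+ 2 <=
   \sum_(i < M) Ex n (fun s => occ X s * occ X (drop i.+1 s)).
  apply: (@le_trans _ _ (\sum_(i < M) - (i.+1 < size X)%:R * prob X ^+ 2)).
    rewrite -mulr_suml ler_wpM2r ?sqr_ge0 // sumrN lerN2.
    have := sum_ltn (size X).-1 M; rewrite -[in (size X)%:R](prednK X0) -natr1 addrK.
    by apply: le_trans; apply: ler_sum => i _; rewrite ler_nat; lia.
  apply: ler_sum => i _; have iM := ltn_ord i.
  by apply: Ex_occ_occ => //; lia.
have := IH (n - 1)%N; move=> /(_ ltac:(lia)).
rewrite -[M.+1%:R]natr1; set p := prob X; set k : R := (size X)%:R.
by lra.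
Qed.

(* A quartic minorant of the indicator function of ]c, +oo[: with the moments
   of order 1, 2 and 4 it yields a one-sided Paley-Zygmund inequality. *)
Lemma quartic_test (v C : R) : 0 < v -> v <= 1 -> 1 <= C ->
  exists al gam c Q : R, [/\ gam * C = v / 2, 0 < gam, 0 < c, 0 < Q &
    forall x, al * x + x ^+ 2 - gam * x ^+ 4 <= v / 4 + Q * (c < x)%R%:R].
Proof.
move=> v0 v1 C1; have C0 : 0 < C by lra.
pose gam := v / (2 * C); have gam0 : 0 < gam by rewrite divr_gt0 // mulr_gt0.
have gam1 : gam <= 1 by rewrite ler_pdivrMr ?mulr_gt0 //; lra.
(* For [x <= 0] the linear term absorbs [x ^ 2] down to [- al]; below, the quartic term does,
   because [gam * al ^ 2 = al >= 1]. *)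
pose al := gam^-1; have al1 : 1 <= al by rewrite invf_ge1.
have alg : al * gam = 1 by rewrite mulVf // lt0r_neq0.
(* On []0, c]], where [x <= 1], the left-hand side is at most [(al + 1) * c = v / 4]. Beyond [c],
   [Q] bounds its maximum, by completing squares. *)
pose c := v / (4 * (al + 1)); have c0 : 0 < c by rewrite divr_gt0 //; lra.
have cv : (al + 1) * c = v / 4 by rewrite /c; field; lra.
have c1 : c <= 1 by nra.
exists al, gam, c, (al ^+ 2 / 2 + 9 * al / 16); split=> //.
- by rewrite /gam; field; lra.
- by nra.
move=> x; rewrite (exprM x 2 2); have [xc|cx] := leP x c.
  rewrite mulr0 addr0; have [x0|x0] := leP x 0; last first.
    have x2 : x ^+ 2 <= x by rewrite expr2; nra.
    by have := sqr_ge0 (x ^+ 2); nra.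
  suff : x ^+ 2 <= al * - x + gam * x ^+ 2 ^+ 2 by lra.
  have [xa|ax] := leP (- x) al.
    apply: (@le_trans _ _ (al * - x)); first by rewrite expr2; nra.
    by rewrite lerDl mulr_ge0 ?sqr_ge0 // ltW.
  have g1 : 1 <= gam * x ^+ 2 by rewrite expr2; nra.
  have ax0 : 0 <= al * - x by nra.
  have := ler_peMl (sqr_ge0 x) g1; rewrite -mulrA -[_ * x ^+ 2]expr2.
  by move: (_ ^+ 2 ^+ 2) => y; lra.
have h1 : al * x <= al ^+ 2 / 2 + x ^+ 2 / 2 by have := sqr_ge0 (al - x); nra.
have h2 : 3 / 2 * x ^+ 2 - gam * x ^+ 2 ^+ 2 <= 9 * al / 16.
  have := mulr_ge0 (ltW gam0) (sqr_ge0 (x ^+ 2 - 3 / 4 * al)).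
  rewrite [X in _ <= X](_ : _ = gam * x ^+ 2 ^+ 2 - 3 / 2 * (al * gam) * x ^+ 2 + 9 / 16 * (al * gam) * al); last by field.
  by rewrite alg; lra.
by rewrite mulr1; lra.
Qed.

(** Expectations are taken in [quartic_test] for the discrepancy divided by [sqrt M]: the linear
    term vanishes, and variance and fourth moment leave at least [v - v / 2] on the left, whence the
    probability [v / (4 * Q)]. Both constants are uniform in [M]. *)
Lemma disc_one_sided X (sg : R) : (0 < size X)%N -> sg ^+ 2 = 1 ->
  exists c pr : R, [/\ 0 < c, 0 < pr & forall M n, (0 < M)%N -> (M + size X <= n.+1)%N ->
    pr <= Pr n (fun s => c * Num.sqrt M%:R < sg * disc X s M)].
Proof.
move=> X0 sg1; set k := size X in X0 *.
have p0 := prob_gt0 R X; have p1 := prob_le1 R X.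
have pow2 n : (0 < n)%N -> (2 * n < (2 ^ n).+1)%N.
  by case: n => // n _; elim: n => // n IH; rewrite expnS; lia.
pose v := prob X * (1 - (2 * k%:R - 1) * prob X).
have kR : 1 <= k%:R :> R by rewrite ler1n.
have v0 : 0 < v.
  rewrite mulr_gt0 // subr_gt0 /prob ltr_pdivrMr ?exprn_gt0 // mul1r -/k.
  rewrite ltrBlDr -natrX natr1 -natrM ltr_nat -/k.
  exact: pow2.
have v1 : v <= 1 by rewrite /v; nra.
have C1 : 1 <= 7 * k%:R ^+ 5 :> R.
  by have : 1 <= k%:R ^+ 5 :> R by [rewrite exprn_ege1|]; lra.
have [al [gam [c [Q [gC g0 c0 Q0 test]]]]] := quartic_test v0 v1 C1.
exists c, (v / (4 * Q)); split=> //; first by rewrite divr_gt0 // mulr_gt0.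
move=> M n M0 Mn; have MR : 0 < M%:R :> R by rewrite ltr0n.
have sM : 0 < Num.sqrt M%:R :> R by rewrite sqrtr_gt0.
pose x s := sg * disc X s M / Num.sqrt M%:R.
have s2 : Num.sqrt M%:R ^+ 2 = M%:R :> R by rewrite sqr_sqrtr // ltW.
have Ex1 : Ex n x = 0.
  by under eq_Ex do rewrite /x mulrAC; rewrite ExZ Ex_disc // mulr0.
have Ex2 : v <= Ex n (fun s => x s ^+ 2).
  under eq_Ex do rewrite /x expr_div_n exprMn sg1 mul1r s2.
  by rewrite ExZr ler_pdivlMr // mulrC Ex_disc2_ge.
have Ex4 : Ex n (fun s => x s ^+ 4) <= 7 * k%:R ^+ 5.
  under eq_Ex do rewrite /x expr_div_n exprMn !(exprM _ 2 2) sg1 expr1n mul1r s2 -exprM.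
  rewrite ExZr ler_pdivrMr ?exprn_gt0 //; apply: le_trans (Ex_disc4 _ Mn) _.
  rewrite -/k [7 * _]mulrC -[leRHS]mulrA ler_wpM2l ?exprn_ge0 //.
  rewrite /quartic !expr0n /= !mulr0 !add0r.
  have M1 : 1 <= M%:R :> R by rewrite ler1n.
  move: (M%:R : R) (prob X) p0 p1 M1 => m q q0 q1 m1.
  have : q * m <= m ^+ 2 by rewrite expr2; nra.
  have : q ^+ 2 <= 1 by rewrite expr2; nra.
  by have := sqr_ge0 m; nra.
have : Ex n (fun s => al * x s + x s ^+ 2 - gam * x s ^+ 4) <=
       Ex n (fun s => v / 4 + Q * (c < x s)%R%:R) by apply: Ex_le => s _; exact: test.
rewrite ExB !ExD !ExZ Ex1 Ex_cst mulr0 add0r => H.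
rewrite ler_pdivrMr ?mulr_gt0 //.
have -> : Pr n (fun s => c * Num.sqrt M%:R < sg * disc X s M) = Ex n (fun s => (c < x s)%R%:R).
  by apply: eq_Ex => s _; rewrite asboolb /x ltr_pdivlMr.
have : gam * Ex n (fun s => x s ^+ 4) <= v / 2 by rewrite -gC ler_pM2l.
by move: Ex2 H; set e := Ex n (fun s => (c < _)%R%:R); nra.
Qed.

End Moments.

(** * Small balls and first passage *)

Section SmallBall.
Variable R : realType.
Implicit Types (X Y s t : seq sign).
Local Notation disc := (disc R).
Local Notation prob := (prob R).
Local Notation Pr := (Pr R).

Lemma sqrt_nat_large (x : R) : exists n0 : nat, forall n, (n0 <= n)%N -> x <= Num.sqrt n%:R.
Proof.
exists (Num.Def.archi_bound (x ^+ 2)) => n n0.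
have [x0|x0] := leP x 0; first exact: le_trans x0 (sqrtr_ge0 _).
rewrite -(ger0_norm (ltW x0)) -sqrtr_sqr ler_wsqrtr //.
apply: le_trans (_ : (Num.Def.archi_bound (x ^+ 2))%:R <= _); last by rewrite ler_nat.
by rewrite ltW // archi_boundP // sqr_ge0.
Qed.

Lemma sqr_sqrt_nat (n : nat) : Num.sqrt n%:R ^+ 2 = n%:R :> R.
Proof. by rewrite sqr_sqrtr. Qed.

Lemma sqrt_nat4 (n : nat) : Num.sqrt n%:R ^+ 4 = n%:R ^+ 2 :> R.
Proof. by rewrite (exprM _ 2 2) sqr_sqrt_nat. Qed.

Definition stays_below X (sg : R) (y : R) (m : nat) (s : seq sign) :=
  forall j, (j + size X <= m.+1)%N -> sg * disc X s j <= y.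

Lemma stays_below_take X sg y m n s : (m <= n)%N ->
  stays_below X sg y m (take n s) <-> stays_below X sg y m s.
Proof.
by move=> mn; split=> H j jm; have := H j jm; rewrite disc_take //; lia.
Qed.

Lemma disc_big_deviation X m M : (0 < m)%N -> (M <= m)%N -> (M + size X <= m.+1)%N ->
  forall C : R, 0 < C ->
  Pr m (fun s => C * Num.sqrt m%:R < `|disc X s M|) <= 7 * (size X)%:R ^+ 5 / C ^+ 4.
Proof.
move=> m0 Mm MX C C0; have sm : 0 < C * Num.sqrt m%:R by rewrite mulr_gt0 // sqrtr_gt0 ltr0n.
apply: (@le_trans _ _ (Pr m (fun s => exists M, [/\ (M <= m)%N, (M + size X <= m.+1)%N & C * Num.sqrt m%:R < `|disc X s M|]))).
  by apply: le_Pr => s _ H; exists M.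
apply: le_trans (Pr_disc _ _ _ sm) _; rewrite exprMn sqrt_nat4.
have M1 : 1 <= m%:R :> R by rewrite ler1n.
have M0 : 0 < m%:R :> R by lra.
rewrite ler_pdivrMr; last by rewrite mulr_gt0 // exprn_gt0.
rewrite [leRHS](_ : _ = (size X)%:R ^+ 5 * (7 * m%:R ^+ 2)); last by field; rewrite lt0r_neq0.
rewrite ler_wpM2l ?exprn_ge0 // /quartic !expr0n /= !mulr0 !add0r.
have p0 := ltW (prob_gt0 R X); have p1 := prob_le1 R X.
have : prob X * m%:R <= m%:R ^+ 2 by rewrite expr2 ler_wpM2r // (le_trans p1).
have : prob X ^+ 2 * m%:R ^+ 2 <= m%:R ^+ 2 by rewrite ler_piMl ?sqr_ge0 // expr_le1.
by lra.
Qed.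

Lemma split_bounds T m0 k m : (4 <= T)%N -> (T * (m0 + k + 2) + 4 * k <= m)%N ->
  [/\ (m0 + k + 2 <= m %/ T)%N, (m %/ T * T <= m)%N, (m %/ T <= m)%N, (m <= 2 * T * (m %/ T))%N &
      (m <= ((m - m %/ T).+1 - k) * 4)%N].
Proof.
move=> T4 mlarge; have le1 : (m %/ T * T <= m)%N by apply: leq_divM.
have lt2 : (m < (m %/ T).+1 * T)%N by rewrite ltn_ceil //; lia.
have ge3 : (m0 + k + 2 <= m %/ T)%N by rewrite leq_divRL; lia.
by move: (m %/ T)%N le1 lt2 ge3 => m1 le1 lt2 ge3; split=> //; nia.
Qed.

(* Split [0, m) at m1, a small fraction of m: the walk at time m1 is negligible
   with respect to the upward move that occurs after m1 with probability at
   least pr, independently of the past. *)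
Lemma stays_below_step X sg : (0 < size X)%N -> sg ^+ 2 = 1 ->
  exists2 pr : R, 0 < pr <= 1 & forall eta theta : R, 0 <= eta -> 0 < theta ->
  (exists2 gam : R, 0 < gam & exists m0 : nat, forall m, (m0 <= m)%N ->
     Pr m (stays_below X sg (gam * Num.sqrt m%:R) m) <= eta) ->
  exists2 gam : R, 0 < gam & exists m0 : nat, forall m, (m0 <= m)%N ->
     Pr m (stays_below X sg (gam * Num.sqrt m%:R) m) <= (1 - pr) * eta + theta.
Proof.
move=> X0 sg1; have [c [pr [c0 pr0 Hpr]]] := disc_one_sided X0 sg1.
set k := size X in X0 Hpr.
have pr1 : pr <= 1.
  by apply: le_trans (Hpr 1%N k _ _) (Pr_le1 _ _ _) => //; lia.
exists pr => [|eta theta eta0 theta0 [gam gam0 [m0 Hm0]]]; first by rewrite pr0.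
have [C C0 HC] : exists2 C : R, 0 < C & 7 * k%:R ^+ 5 / C ^+ 4 <= theta.
  have k7 : 0 <= 7 * k%:R ^+ 5 :> R by rewrite mulr_ge0 // exprn_ge0.
  exists (1 + 7 * k%:R ^+ 5 / theta); first by rewrite ltr_pwDl // divr_ge0 // ltW.
  set x := _ / theta; have x0 : 0 <= x by rewrite divr_ge0 // ltW.
  rewrite ler_pdivrMr ?exprn_gt0 //; last by lra.
  rewrite -ler_pdivrMl // mulrC -/x exprS.
  by have : 1 <= (1 + x) ^+ 3 by [rewrite exprn_ege1//; lra]; nra.
have [T0 T02 T0C] : exists2 T0 : nat, (2 <= T0)%N & 8 * C / c <= T0%:R.
  exists (Num.Def.archi_bound (8 * C / c)).+2 => //.
  apply: le_trans (ltW (archi_boundP _)) _; first by rewrite divr_ge0 ?mulr_ge0 // ltW.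
  by rewrite ler_nat ltnW.
(* With [T = T0 ^ 2], [sqrt m1] is at most [sqrt m / T0], and [T0] is so large that [C * sqrt m1],
   the likely range of the walk at [m1], is below [c / 8 * sqrt m]. *)
have [T TE T4] : exists2 T, T = (T0 * T0)%N & (4 <= T)%N.
  by exists (T0 * T0)%N => //; apply: (@leq_mul 2 2).
have TR : 0 < T%:R :> R by rewrite ltr0n (leq_trans _ T4).
have T0R : 0 < T0%:R :> R by rewrite ltr0n (leq_trans _ T02).
(* The first bound puts the barrier for [m] below the barrier for [m1]. The second leaves [c / 8]
   each for the barrier, the walk near [m1] and the windows straddling [m1], against a rise of
   [c / 2], all in units of [sqrt m]. *)
pose gam' := Num.min (gam / (2 * T%:R)) (c / 8).
have gam'0 : 0 < gam' by rewrite lt_min !divr_gt0 // mulr_gt0.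
exists gam' => //.
have [n1 Hn1] := sqrt_nat_large (8 * k%:R / c).
exists (maxn n1 (T * (m0 + k + 2) + 4 * k)) => m; rewrite geq_max => /andP[mn1 mlarge].
have km : 8 * k%:R / c <= Num.sqrt m%:R by apply: Hn1.
set r := Num.sqrt m%:R in km *; have r0 : 0 <= r by rewrite sqrtr_ge0.
have [m1_ge m1T m1m m1T2 j2_ge] := split_bounds T4 mlarge.
set m1 := (m %/ T)%N in m1_ge m1T m1m m1T2 j2_ge *; pose m2 := (m - m1)%N.
have m1k : (k <= m1)%N by apply: leq_trans m1_ge; rewrite -addnA addnCA leq_addr.
have m10 : (m0 <= m1)%N by apply: leq_trans m1_ge; rewrite -addnA leq_addr.
have m1_gt0 : (0 < m1)%N by apply: leq_trans m1_ge; rewrite addn2.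
have m1m2 : (m1 + m2 = m)%N by rewrite subnKC.
pose j1 := (m1.+1 - k)%N; pose j2 := (m2.+1 - k)%N.
have j1k : (j1 + k = m1.+1)%N by rewrite subnK // ltnW.
have j1m : (j1 <= m1)%N by rewrite leq_subLR -add1n leq_add2r.
have m1j : (m1 - j1 <= k)%N by rewrite leq_subLR j1k.
rewrite -/m2 -/j2 in j2_ge.
have j2_gt0 : (0 < j2)%N by move: (leq_trans m1_gt0 (leq_trans m1m j2_ge)); case: (j2).
have j2k : (j2 + k = m2.+1)%N by rewrite subnK // ltnW // -subn_gt0.
have s1 : Num.sqrt m1%:R <= r / T0%:R.
  rewrite -[X in _ / X](ger0_norm (ltW T0R)) -sqrtr_sqr -sqrtrV ?sqr_ge0 // -sqrtrM //.
  by rewrite ler_wsqrtr // ler_pdivlMr ?exprn_gt0 // -natrX -natrM ler_nat expnS expn1 -TE.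
have s1' : r <= 2 * T%:R * Num.sqrt m1%:R.
  have T20 : 0 <= 2 * T%:R :> R by rewrite mulr_ge0.
  rewrite -[2 * _](ger0_norm T20) -sqrtr_sqr -sqrtrM ?sqr_ge0 //.
  rewrite ler_wsqrtr // -natrM -natrX -natrM ler_nat expnS expn1 (leq_trans m1T2) //.
  by rewrite leq_mul // leq_pmulr // muln_gt0 (leq_trans _ T4).
have s2 : r / 2 <= Num.sqrt j2%:R.
  rewrite ler_pdivrMr // -[X in _ <= _ * X](ger0_norm (_ : 0 <= 2)) // -sqrtr_sqr -sqrtrM //.
  by rewrite ler_wsqrtr // -natrX -natrM ler_nat.
have g1 : gam' * r <= gam * Num.sqrt m1%:R.
  apply: (@le_trans _ _ (gam / (2 * T%:R) * r)); first by rewrite ler_wpM2r // ge_min lexx.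
  rewrite -mulrA ler_pM2l // ler_pdivrMl ?mulr_gt0 //.
have g2 : gam' * r <= c / 8 * r by rewrite ler_wpM2r // ge_min lexx orbT.
have Cs1 : C * Num.sqrt m1%:R <= c / 8 * r.
  apply: (@le_trans _ _ (C * (r / T0%:R))); first by rewrite ler_pM2l.
  rewrite mulrCA mulrC ler_wpM2r // ler_pdivrMr //.
  by move: T0C; rewrite ler_pdivrMr //; lra.
have kr : k%:R <= c / 8 * r by move: km; rewrite ler_pdivrMr //; lra.
have cs2 : c / 2 * r <= c * Num.sqrt j2%:R by rewrite -mulrA ler_pM2l // mulrC.
pose A s := stays_below X sg (gam * Num.sqrt m1%:R) m1 s.
pose B s := ~ c * Num.sqrt j2%:R < sg * disc X s j2.
pose D s := C * Num.sqrt m1%:R < `|disc X s j1|.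
have sgn (x : R) : `|sg * x| = `|x|.
  have /eqP : sg ^+ 2 = 1 ^+ 2 by rewrite expr1n.
  by rewrite eqf_sqr => /orP[] /eqP ->; rewrite ?mulN1r ?normrN ?mul1r.
apply: (@le_trans _ _ (Pr m (fun s => (A (take m1 s) /\ B (drop m1 s)) \/ D (take m1 s)))).
  apply: le_Pr => s sm; rewrite /stays_below -/k => H.
  have [Ds|nDs] := pselect (D (take m1 s)); [by right | left; split].
    move=> j; rewrite -/k => jm; rewrite disc_take //; apply: le_trans g1; apply: H.
    by rewrite (leq_trans jm).
  rewrite /B => Hj2.
  have : sg * disc X s (m1 + j2) <= gam' * r by apply: H; rewrite -addnA j2k addnS m1m2.
  rewrite discD -{1}(subnKC j1m) discD.
  move/negP: nDs; rewrite /D disc_take -?leNgt; last by rewrite -/k j1k.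
  rewrite -sgn ler_norml => /andP[h _].
  have : `|sg * disc X (drop j1 s) (m1 - j1)| <= k%:R.
    by rewrite sgn (le_trans (ler_norm_disc _ _ _ _)) // ler_nat.
  rewrite ler_norml => /andP[h2 _].
  have cr0 : 0 <= c * r by rewrite mulr_ge0 // ltW.
  by rewrite !mulrDr; move: (k%:R : R) kr h2 => x; lra.
apply: le_trans (PrU _ _ _ _) _.
apply: lerD; last first.
  rewrite (Pr_take R D) /m1 ?leq_div //; apply: le_trans HC.
  by apply: disc_big_deviation; rewrite -/k ?j1k.
rewrite (Pr_indep R A B) ?leq_div // mulrC.
apply: ler_pM; rewrite ?Pr_ge0 //; last exact: Hm0.
by rewrite PrC lerB // Hpr // j2k.
Qed.

(** Starting from the trivial bound 1, each use of [stays_below_step] multiplies the bound by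
    [1 - pr], up to an arbitrarily small additive error. *)
Lemma small_ball X sg : (0 < size X)%N -> sg ^+ 2 = 1 -> forall eta : R, 0 < eta ->
  exists2 gam : R, 0 < gam & exists m0 : nat, forall m, (m0 <= m)%N ->
     Pr m (stays_below X sg (gam * Num.sqrt m%:R) m) <= eta.
Proof.
move=> X0 sg1 eta eta0; have [pr /andP[pr0 pr1] Hstep] := stays_below_step X0 sg1.
have main I theta : 0 < theta -> exists2 gam : R, 0 < gam & exists m0 : nat, forall m, (m0 <= m)%N ->
     Pr m (stays_below X sg (gam * Num.sqrt m%:R) m) <= (1 - pr) ^+ I + theta.
  elim: I theta => [|I IH] theta theta0.
    by exists 1 => //; exists 0%N => m _; rewrite (le_trans (Pr_le1 _ _ _)) // expr0 lerDl ltW.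
  have t2 : 0 < theta / 2 by rewrite divr_gt0.
  have q0 : 0 <= (1 - pr) ^+ I by rewrite exprn_ge0 // subr_ge0.
  have [|gam gam0 [m0 H]] := Hstep _ _ _ t2 (IH _ t2); first by lra.
  exists gam => //; exists m0 => m /H /le_trans; apply.
  by rewrite exprS mulrDr; nra.
have [I HI] : exists I, (1 - pr) ^+ I <= eta / 2.
  have e2 : 0 < eta / 2 by rewrite divr_gt0.
  have : ((1 - pr) ^+ n @[n --> \oo] --> (0 : R))%classic.
    by apply: cvg_expr; rewrite ger0_norm; lra.
  move=> /cvgrPdist_le /(_ _ e2) [I _ /(_ I (leqnn I))].
  by rewrite sub0r normrN => /(le_trans (ler_norm _)); exists I.
have [|gam gam0 [m0 H]] := main I (eta / 2); first by rewrite divr_gt0.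
by exists gam => //; exists m0 => m /H /le_trans; apply; lra.
Qed.

Lemma sum_asbool_le1 (r : seq nat) (A : nat -> Prop) : uniq r ->
  (forall i j, A i -> A j -> i = j) -> \sum_(i <- r) `[<A i>]%:R <= 1 :> R.
Proof.
move=> ur A1; have [[i Ai ir]|nA] := pselect (exists2 i, A i & i \in r).
  rewrite (bigD1_seq i) //= asboolT // big1 ?addr0 // => j /eqP ji.
  by rewrite asboolF // => Aj; apply: ji; exact: A1.
rewrite big_seq big1 // => i ir; rewrite asboolF // => Ai.
by apply: nA; exists i.
Qed.

(** Strong Markov property at the first time [M] above [x]. That time is decided by the first
    [(M + k).-1] signs, all that the first [M] windows read; the later signs are independent of it.
    The windows overlapping both parts lose at most [k], so the fresh walk must stay below [g + k].
    The first passage events are disjoint, so their probabilities sum to at most 1. *)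
Lemma first_passage X sg N m (x g : R) : (0 < size X)%N -> `|sg| = 1 ->
  Pr (N + m) (fun s => (exists M, (M + size X <= N.+1)%N /\ x < sg * disc X s M) /\
     stays_below X sg (x + g) (N + m) s)
  <= Pr m (stays_below X sg (g + (size X)%:R) m).
Proof.
set k := size X => X0 sg1.
pose F s M := x < sg * disc X s M /\ forall M', (M' < M)%N -> sg * disc X s M' <= x.
pose B := stays_below X sg (g + k%:R) m.
pose r := iota 0 (N.+1 - k).+1.
apply: (@le_trans _ _ (Pr (N + m) (fun s => exists2 M, M \in [seq M <- r | (M + k <= N.+1)%N] &
    F (take (M + k).-1 s) M /\ B (drop (M + k).-1 s)))).
  apply: le_Pr => s sm [exM stay].
  pose P M := `[<(M + k <= N.+1)%N /\ x < sg * disc X s M>].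
  have [|M /asboolP[MN xM] Mmin] := @ex_minnP P.
    by have [M HM] := exM; exists M; apply/asboolP.
  exists M; first by rewrite mem_filter MN mem_iota; lia.
  have dt M' : (M' <= M)%N -> disc X (take (M + k).-1 s) M' = disc X s M'.
    by move=> M'M; rewrite disc_take //; rewrite -/k; lia.
  split; first split=> [|M' M'M].
  - by rewrite dt.
  - rewrite dt ?(ltnW M'M) // leNgt; apply/negP => xM'.
    suff /Mmin : P M' by rewrite leqNgt M'M.
    by apply/asboolP; split=> //; lia.
  move=> j jm; have : sg * disc X s ((M + k).-1 + j) <= x + g.
    by apply: stay; rewrite -/k in jm *; lia.
  have -> : ((M + k).-1 = M + k.-1)%N by lia.
  rewrite [disc X s _]discD discD.
  have : `|sg * disc X (drop M s) k.-1| <= k%:R.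
    by rewrite normrM sg1 mul1r (le_trans (ler_norm_disc _ _ _ _)) // ler_nat; lia.
  rewrite ler_norml => /andP[h _].
  by rewrite !mulrDr; move: (k%:R : R) h => y; lra.
apply: le_trans (Pr_bigU _ _ _ _) _; rewrite big_filter.
apply: (@le_trans _ _ (\sum_(M <- r | (M + k <= N.+1)%N) Pr (N + m) (F ^~ M) * Pr m B)).
  apply: ler_sum => M MN.
  rewrite (Pr_indep R (F ^~ M) B); last by lia.
  rewrite -(Pr_take R (F ^~ M) (_ : (M + k).-1 <= N + m)%N); last by lia.
  apply: ler_pM; rewrite ?Pr_ge0 //; first apply: le_Pr => s sm.
    have dt M' : (M' <= M)%N -> disc X (take (M + k).-1 s) M' = disc X s M'.
      by move=> M'M; rewrite disc_take //; rewrite -/k; lia.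
    rewrite /F dt // => -[? H]; split=> // M' M'M.
    by rewrite -dt ?(ltnW M'M) // H.
  rewrite -[in leRHS](Pr_take R B (_ : m <= N + m - (M + k).-1)%N); last by lia.
  by apply: le_Pr => s _ H; apply/stays_below_take.
rewrite -mulr_suml ler_piMl ?Pr_ge0 // -Ex_sum -[leRHS](Ex_cst (N + m)).
apply: Ex_le => s _; rewrite -big_filter; apply: sum_asbool_le1.
  by rewrite filter_uniq // iota_uniq.
move=> i j [xi Hi] [xj Hj]; case: (ltngtP i j) => // [/Hj|/Hi].
  by rewrite leNgt xi.
by rewrite leNgt xj.
Qed.

End SmallBall.

(** * Jumps of the distribution functions *)

Section AntiConcentration.
Variable R : realType.
Implicit Types (X Y s : seq sign).
Local Notation disc := (disc R).
Local Notation prob := (prob R).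
Local Notation Pr := (Pr R).

Definition normality_le (N : nat) (y : R) s :=
  forall X M, (0 < size X)%N -> (2 ^ size X <= N)%N -> (M + size X <= N.+1)%N ->
    `|disc X s M| <= y.

Definition normality_cdf (N : nat) (t : R) : R :=
  Pr N (normality_le N (t * Num.sqrt N%:R)).

Lemma normality_le_take N n y s : (N <= n)%N ->
  normality_le N y (take N s) <-> normality_le N y s.
Proof.
by move=> Nn; split=> H X M X0 XN MN; have := H X M X0 XN MN; rewrite disc_take.
Qed.

Lemma normality_le_ge0 N y s : (2 <= N)%N -> normality_le N y s -> 0 <= y.
Proof.
move=> N2 /(_ [:: SeqSub (mem_head (-1 : int) [:: 1])] 0%N) /=.
by rewrite disc0 normr0; apply; rewrite ?expn1 //; lia.
Qed.

Lemma normality_cdf_mono N t t' : t <= t' -> normality_cdf N t <= normality_cdf N t'.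
Proof.
move=> tt'; apply: le_Pr => s _ H X M X0 XN MN.
by rewrite (le_trans (H X M X0 XN MN)) // ler_wpM2r // sqrtr_ge0.
Qed.

Lemma normality_cdf_lt0 N t : (2 <= N)%N -> t < 0 -> normality_cdf N t = 0.
Proof.
move=> N2 t0; apply: Pr_eq0 => s _ /(normality_le_ge0 N2).
by rewrite pmulr_lge0 ?sqrtr_gt0 ?ltr0n ?leNgt ?t0 // (leq_trans _ N2).
Qed.

Lemma uniform_threshold (I : eqType) (r : seq I) (Q : I -> R -> nat -> Prop) :
  (forall i g g' m m', 0 < g' -> g' <= g -> (m <= m')%N -> Q i g m -> Q i g' m') ->
  (forall i, i \in r -> exists2 g, 0 < g & exists m, Q i g m) ->
  exists2 g, 0 < g & exists m, forall i, i \in r -> Q i g m.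
Proof.
move=> Qmono; elim: r => [|i r IH] H; first by exists 1 => //; exists 0%N.
have [g1 g10 [m1 H1]] := H i (mem_head _ _).
have [|g2 g20 [m2 H2]] := IH; first by move=> j jr; apply: H; rewrite in_cons jr orbT.
exists (Num.min g1 g2); first by rewrite lt_min g10.
exists (maxn m1 m2) => j; rewrite in_cons => /orP[/eqP ->|/H2].
  by apply: Qmono H1; rewrite ?lt_min ?g10 ?ge_min ?lexx // leq_maxl.
by apply: Qmono; rewrite ?lt_min ?g10 ?ge_min ?lexx ?orbT // leq_maxr.
Qed.

Lemma uniform_small_ball K (eta : R) : 0 < eta ->
  exists2 gam : R, 0 < gam & exists m0 : nat,
  forall X (b : bool) m, (0 < size X <= K)%N -> (m0 <= m)%N ->
     Pr m (stays_below X ((-1) ^+ b) (gam * Num.sqrt m%:R) m) <= eta.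
Proof.
move=> eta0.
pose Q (i : K.-bseq sign * bool) (g : R) (m0 : nat) := forall m, (m0 <= m)%N ->
  (0 < size i.1)%N ->
  Pr m (stays_below i.1 ((-1) ^+ i.2) (g * Num.sqrt m%:R) m) <= eta.
have [|i _|g g0 [m0 H]] := @uniform_threshold _ (enum [set: K.-bseq sign * bool]) Q.
- move=> i g g' m m' g'0 g'g mm' H n m'n X0.
  apply: le_trans (H n (leq_trans mm' m'n) X0).
  apply: le_Pr => s _ Hs j jn; rewrite (le_trans (Hs j jn)) //.
  by rewrite ler_wpM2r // sqrtr_ge0.
- have [X0|X0] := ltnP 0 (size i.1); last first.
    by exists 1 => //; exists 0%N => m _; rewrite ltnNge X0.
  have [|g g0 [m0 H]] := small_ball X0 (_ : ((-1) ^+ i.2) ^+ 2 = 1) eta0; first exact: sqrr_sign.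
  by exists g => //; exists m0 => m m0m _; exact: H.
exists g => //; exists m0 => X b m /andP[X0 XK] m0m.
by apply: (H (Bseq XK, b)) => //; rewrite mem_enum inE.
Qed.

Lemma geometric_small (C eta : R) : 0 < eta -> exists K, C * (3 / 4) ^+ K <= eta.
Proof.
move=> eta0.
have : ((fun n => C * (3 / 4) ^+ n) @ \oo --> (C * 0 : R))%classic.
  by apply: cvgMr; apply: cvg_expr; rewrite ger0_norm; lra.
rewrite mulr0 => /cvgrPdist_le /(_ _ eta0) [K _ /(_ K (leqnn K))].
by rewrite sub0r normrN => /(le_trans (ler_norm _)); exists K.
Qed.

Definition long_pattern_deviates K N (lam : R) s :=
  exists X M, [/\ (K < size X)%N, (2 ^ size X <= N)%N, (M + size X <= N.+1)%N &
                    lam < `|disc X s M|].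

Lemma long_patterns_negligible (e eta : R) : 0 < e -> 0 < eta ->
  exists K, forall N, (0 < N)%N ->
    Pr N (long_pattern_deviates K N (e * Num.sqrt N%:R)) <= eta.
Proof.
move=> e0 eta0; have [C C0 H] := Pr_long_patterns R.
have [K HK] := geometric_small (C / e ^+ 4) eta0.
by exists K => N N0; apply: le_trans (H e K N e0 N0) HK.
Qed.

(** For an extension by the fraction [delta = 1 / (2 * T0 ^ 2)], the walk moves on the scale
    [sqrt N / T0], whereas the normalization changes only by a relative amount of order
    [1 / T0 ^ 2]. *)
Lemma divn_sqrt_bounds (T0 N : nat) : (0 < T0)%N -> (2 * (T0 * T0) <= N)%N ->
  let m := (N %/ (2 * (T0 * T0)))%N in
  Num.sqrt N%:R <= 2 * T0%:R * Num.sqrt m%:R :> R /\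
  Num.sqrt (N + m)%:R <= (1 + (2 * (T0%:R * T0%:R))^-1) * Num.sqrt N%:R :> R.
Proof.
set T := (2 * (T0 * T0))%N => T00 TN m.
have T_gt0 : (0 < T)%N by rewrite /T !muln_gt0 T00.
have m0 : (0 < m)%N by rewrite divn_gt0.
have mT : (m * T <= N)%N by apply: leq_divM.
have Nm : (N < m.+1 * T)%N by rewrite ltn_ceil.
have T0R : 0 <= T0%:R :> R by [].
have ER : (2 * (T0%:R * T0%:R)) = T%:R :> R by rewrite /T !natrM.
split.
  have T20 : 0 <= 2 * T0%:R :> R by rewrite mulr_ge0.
  rewrite -[2 * _](ger0_norm T20) -sqrtr_sqr -sqrtrM ?sqr_ge0 // ler_wsqrtr //.
  rewrite -natrM -natrX -natrM ler_nat (_ : (2 * T0) ^ 2 = 2 * T)%N; last by rewrite /T; lia.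
  by apply: leq_trans (ltnW Nm) _; nia.
rewrite ER; have TR : 0 < T%:R :> R by rewrite ltr0n.
have T10 : 0 <= 1 + T%:R^-1 :> R by rewrite addr_ge0 // invr_ge0.
rewrite -[1 + _](ger0_norm T10) -sqrtr_sqr -sqrtrM ?sqr_ge0 // ler_wsqrtr //.
apply: (@le_trans _ _ ((1 + T%:R^-1) * N%:R)).
  rewrite mulrDl mul1r natrD lerD2l mulrC ler_pdivlMr // -natrM ler_nat //.
rewrite ler_wpM2r // expr2 ler_peMl // lerDl invr_ge0 //.
Qed.

Lemma normality_cdf_jump (t eta : R) : 0 < eta ->
  exists z y : R, [/\ z < t, t < y & exists N0, forall N, (N0 <= N)%N ->
    exists2 N', (N <= N')%N & normality_cdf N' y <= normality_cdf N z + eta].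
Proof.
move=> eta0; have [t0|] := ltP t 0.
  exists (t - 1), (t / 2); split; [lra|lra|exists 2 => N N2; exists N => //].
  by rewrite !normality_cdf_lt0 //; lra.
rewrite le_eqVlt => /orP[/eqP <-|t0].
  (* At [t = 0] no extension of the sequence is needed: a single pattern of length one is unlikely
     to stay below [gam * sqrt N]. *)
  have [gam gam0 [m0 H]] := uniform_small_ball 1 eta0.
  exists (-1), gam; split; [lra|lra|exists (maxn m0 2) => N; rewrite geq_max => /andP[m0N N2]].
  exists N => //; rewrite [X in _ <= X + _]normality_cdf_lt0 // ?add0r.
  pose X : seq sign := [:: SeqSub (mem_head (-1 : int) [:: 1])].
  apply: le_trans (H X false N isT m0N).
  apply: le_Pr => s _ Hs j jN; rewrite expr0 mul1r.
  by apply: le_trans (ler_norm _) _; apply: Hs => //; rewrite expn1.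
have e2 : 0 < eta / 2 by lra.
(* For [t > 0], every level used below is at least [t / 2 * sqrt N], a height that long patterns are
   unlikely to reach. *)
have t2 : 0 < t / 2 by lra.
have [K HK] := long_patterns_negligible t2 e2.
pose I : finType := (K.-bseq sign * bool)%type.
have e3 : 0 < eta / (2 * #|I|.+1%:R) by rewrite divr_gt0 // mulr_gt0.
have [gam gam0 [m0 Hgam]] := uniform_small_ball K e3.
have [T0 T00 T0g] : exists2 T0 : nat, (0 < T0)%N & 4 * (t + 1) / gam <= T0%:R.
  exists (Num.Def.archi_bound (4 * (t + 1) / gam)).+1 => //.
  by apply: le_trans (ltW (archi_boundP _)) _; rewrite ?ler_nat // divr_ge0 ?mulr_ge0 //; lra.
have T0R : 0 < T0%:R :> R by rewrite ltr0n.
(* The move [gam * sqrt m] is worth at least [4 * h * sqrt N]. The change of normalization, the gap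
   [2 * rho] between the two levels and the [K] lost at the passage cost at most [h * sqrt N] each;
   the choice of [T0] serves the first of these. *)
pose h := gam / (8 * T0%:R); have h0 : 0 < h by rewrite divr_gt0 // mulr_gt0.
pose rho := Num.min (h / 2) (Num.min (t / 2) 1).
have rho0 : 0 < rho by rewrite !lt_min; apply/and3P; split; lra.
have rhoh : rho <= h / 2 by rewrite /rho ge_min lexx.
have rhot : rho <= t / 2 by rewrite /rho !ge_min lexx orbT.
have rho1 : rho <= 1 by rewrite /rho !ge_min lexx !orbT.
have [n1 Hn1] := sqrt_nat_large (K%:R / h).
exists (t - rho), (t + rho); split; [lra|lra|].
exists (maxn n1 (maxn (2 ^ K) (2 * (T0 * T0) * m0.+1))) => N.
rewrite !geq_max => /and3P[n1N KN TN].
pose m := (N %/ (2 * (T0 * T0)))%N.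
have T2 : (0 < 2 * (T0 * T0))%N by rewrite !muln_gt0 T00.
have mm0 : (m0 <= m)%N by rewrite leq_divRL // mulnC (leq_trans _ TN) // leq_mul.
have [|s1 s2] := divn_sqrt_bounds T00 (_ : 2 * (T0 * T0) <= N)%N.
  by rewrite (leq_trans _ TN) // leq_pmulr.
rewrite -/m in s1 s2; exists (N + m)%N; first exact: leq_addr.
have N0 : (0 < N)%N by rewrite (leq_trans _ KN) // expn_gt0.
pose x := (t - rho) * Num.sqrt N%:R; pose x' := (t + rho) * Num.sqrt (N + m)%:R.
have gapK : (x' - x) + K%:R <= gam * Num.sqrt m%:R.
  have Ks : K%:R <= h * Num.sqrt N%:R by have := Hn1 _ n1N; rewrite ler_pdivrMr // mulrC.
  have q0 : 0 <= Num.sqrt N%:R :> R by exact: sqrtr_ge0.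
  have gs : 4 * h * Num.sqrt N%:R <= gam * Num.sqrt m%:R.
    have -> : gam = 4 * h * (2 * T0%:R) by rewrite /h; field; rewrite lt0r_neq0.
    by rewrite -[leRHS]mulrA ler_wpM2l // mulr_ge0 // ltW.
  have xs : x' <= (t + rho) * (1 + (2 * (T0%:R * T0%:R))^-1) * Num.sqrt N%:R.
    by rewrite /x' -mulrA ler_wpM2l //; lra.
  have th : (t + rho) * (2 * (T0%:R * T0%:R))^-1 <= h.
    rewrite ler_pdivrMr ?mulr_gt0 // /h [leRHS](_ : _ = gam * T0%:R / 4); last first.
      by field; rewrite lt0r_neq0.
    by move: T0g; rewrite ler_pdivrMr //; lra.
  have th' := ler_wpM2r q0 th; have rh' := ler_wpM2r q0 rhoh.
  have hq := mulr_ge0 (ltW h0) q0.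
  move: xs th' rh' gs Ks hq; rewrite /x.
  move: x' (Num.sqrt N%:R) (_ * Num.sqrt m%:R) (_^-1) => a b c d.
  rewrite [X in a <= X](_ : _ = (t + rho) * b + (t + rho) * d * b); last by ring.
  by clearbody h rho; lra.
pose FP (i : I) s := (exists M, (M + size i.1 <= N.+1)%N /\ x < (-1) ^+ i.2 * disc i.1 s M) /\
     stays_below i.1 ((-1) ^+ i.2) (x + (x' - x)) (N + m) s.
pose FP' (i : I) s := (0 < size i.1)%N /\ FP i s.
pose LP s := long_pattern_deviates K N (t / 2 * Num.sqrt N%:R) s.
(* If the bound holds at length [N + m] but the lower level [x] was passed before [N], either a long
   pattern did it, or a short one passed [x] and failed to gain [x' - x] afterwards. The sign of the
   discrepancy at the passage selects the one-sided walk. *)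
apply: (@le_trans _ _ (Pr (N + m) (fun s => normality_le N x (take N s) \/
   (LP (take N s) \/ exists2 i : I, i \in index_enum I & FP' i s)))).
  apply: le_Pr => s sN Hs; have [good|bad] := pselect (normality_le N x s).
    by left; apply/(normality_le_take _ _ (leq_addr m N)).
  right; have [X [M [X0 XN MN xM]]] : exists X M, [/\ (0 < size X)%N, (2 ^ size X <= N)%N,
    (M + size X <= N.+1)%N & x < `|disc X s M|].
    apply: contrapT => H; apply: bad => X M X0 XN MN; rewrite leNgt; apply/negP => xM.
    by apply: H; exists X, M.
  have [XK|KX] := leqP (size X) K; [right|left].
    pose b := disc X s M < 0.
    exists (Bseq XK, b); first exact: mem_index_enum.
    split=> //; split=> /=.
      by exists M; rewrite -normrEsign.
    move=> j jN; rewrite [leRHS]addrC subrK.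
    apply: le_trans (ler_norm _) _; rewrite normrMsign; apply: Hs => //.
    by rewrite (leq_trans XN) // leq_addr.
  exists X, M; split=> //; rewrite disc_take // (le_lt_trans _ xM) //.
  by rewrite /x ler_wpM2r ?sqrtr_ge0 //; lra.
apply: le_trans (PrU _ _ _ _) _; apply: lerD.
  by rewrite (Pr_take R (normality_le N x)) // leq_addr.
apply: le_trans (PrU _ _ _ _) _; rewrite [leRHS](_ : eta = eta / 2 + eta / 2); last by lra.
apply: lerD.
  by rewrite (Pr_take R LP) ?leq_addr // HK.
apply: le_trans (Pr_bigU _ _ _ _) _.
apply: (@le_trans _ _ (\sum_(i : I) eta / (2 * #|I|.+1%:R))).
  apply: ler_sum => i _; have [X0|X0] := posnP (size i.1).
    by rewrite Pr_eq0 ?(ltW e3) // => s _; rewrite /FP' X0 => -[].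
  apply: le_trans (Hgam (i.1 : seq sign) i.2 m _ mm0); last by rewrite X0 size_bseq.
  apply: (@le_trans _ _ (Pr (N + m) (FP i))); first by apply: le_Pr => s _ [].
  apply: le_trans (first_passage _ _ _ _ X0 _) _; first by rewrite normr_sign.
  apply: le_Pr => s _ Hs j jm; apply: le_trans (Hs j jm) _; apply: le_trans gapK.
  by rewrite lerD2l ler_nat size_bseq.
rewrite sumr_const -[_ *+ _]mulr_natr invfM mulrA -mulrA ler_piMr ?(ltW e2) //.
by rewrite ler_pdivrMl // mulr1 ler_nat leqnSn.
Qed.

End AntiConcentration.

(** * Lindeberg replacement *)

Section Lindeberg.
Variables (R : realType) (I : finType).
Implicit Types (x b : I -> R) (F G : (I -> R) -> R).

Definition vadd x b : I -> R := fun i => x i + b i.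
Definition norm1 b : R := \sum_i `|b i|.

Lemma norm1_ge0 b : 0 <= norm1 b. Proof. exact: sumr_ge0. Qed.

Lemma ler_norm1 b i : `|b i| <= norm1 b.
Proof. by rewrite /norm1 (bigD1 i) //= lerDl sumr_ge0. Qed.

(* A uniform second order Taylor expansion, A and Q being the gradient and
   half of the Hessian of F. *)
Definition taylor2 (C : R) F (A : (I -> R) -> I -> R) (Q : (I -> R) -> I -> I -> R) :=
  forall x, [/\ `|F x| <= C, (forall i, `|A x i| <= C), (forall i j, `|Q x i j| <= C) &
  forall b, `|F (vadd x b) - F x - \sum_i A x i * b i - \sum_i \sum_j Q x i j * (b i * b j)|
    <= C * norm1 b ^+ 3].

Definition smooth2 F := exists C A Q, 0 <= C /\ taylor2 C F A Q.

Lemma taylor2_le C C' F A Q : C <= C' -> taylor2 C F A Q -> taylor2 C' F A Q.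
Proof.
move=> CC' H x; have [H1 H2 H3 H4] := H x; split=> [|i|i j|b].
- exact: le_trans CC'.
- exact: le_trans (H2 i) CC'.
- exact: le_trans (H3 i j) CC'.
- by apply: le_trans (H4 b) _; rewrite ler_wpM2r // exprn_ge0 // norm1_ge0.
Qed.

Lemma ler_norm_mul (a b c d : R) : `|a| <= c -> `|b| <= d -> `|a * b| <= c * d.
Proof. by move=> ac bd; rewrite normrM ler_pM. Qed.

Lemma linear_le C (A b : I -> R) : (forall i, `|A i| <= C) ->
  `|\sum_i A i * b i| <= C * norm1 b.
Proof.
move=> AC; rewrite (le_trans (ler_norm_sum _ _ _)) // /norm1 mulr_sumr.
by apply: ler_sum => i _; apply: ler_norm_mul.
Qed.

Lemma quadratic_le C (Q : I -> I -> R) b : (forall i j, `|Q i j| <= C) ->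
  `|\sum_i \sum_j Q i j * (b i * b j)| <= C * norm1 b ^+ 2.
Proof.
move=> QC; rewrite (le_trans (ler_norm_sum _ _ _)) //.
have -> : C * norm1 b ^+ 2 = \sum_i `|b i| * (C * norm1 b).
  by rewrite -mulr_suml -/(norm1 b); ring.
apply: ler_sum => i _; under eq_bigr do rewrite mulrCA.
by rewrite -mulr_sumr; apply: ler_norm_mul => //; apply: linear_le.
Qed.

Lemma taylor2_product (C n f g f' g' L1 L2 Q1 Q2 : R) : 0 <= n ->
  `|f| <= C -> `|g| <= C -> `|f'| <= C -> `|g'| <= C ->
  `|L1| <= C * n -> `|L2| <= C * n -> `|Q1| <= C * n ^+ 2 -> `|Q2| <= C * n ^+ 2 ->
  `|f' - f - L1 - Q1| <= C * n ^+ 3 -> `|g' - g - L2 - Q2| <= C * n ^+ 3 ->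
  `|f' * g' - f * g - (f * L2 + g * L1) - (f * Q2 + g * Q1 + L1 * L2)| <= 7 * C ^+ 2 * n ^+ 3.
Proof.
move=> n0 fC gC f'C g'C L1C L2C Q1C Q2C.
set r1 := f' - f - L1 - Q1; set r2 := g' - g - L2 - Q2 => r1C r2C.
have C0 : 0 <= C by apply: le_trans fC.
have CC := sqr_ge0 C.
have [n1|n1] := leP n 1.
  rewrite [X in `|X|](_ : _ = r1 * g' + f' * r2 - r1 * r2 + L1 * Q2 + Q1 * L2 + Q1 * Q2);
    last by rewrite /r1 /r2; ring.
  have n3 : n ^+ 3 <= 1 by rewrite exprn_ile1.
  have n30 : 0 <= n ^+ 3 by rewrite exprn_ge0.
  have := ler_norm_mul r1C g'C; have := ler_norm_mul f'C r2C.
  have := ler_norm_mul r1C r2C; have := ler_norm_mul L1C Q2C.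
  have := ler_norm_mul Q1C L2C; have := ler_norm_mul Q1C Q2C => h1 h2 h3 h4 h5 h6.
  have e1 : C * n ^+ 2 * (C * n ^+ 2) <= C ^+ 2 * n ^+ 3.
    rewrite [leLHS](_ : _ = C ^+ 2 * n ^+ 3 * n); last by ring.
    by rewrite ler_piMr // mulr_ge0.
  have e4 : C * n ^+ 3 * (C * n ^+ 3) <= C ^+ 2 * n ^+ 3.
    rewrite [leLHS](_ : _ = C ^+ 2 * n ^+ 3 * n ^+ 3); last by ring.
    by rewrite ler_piMr // mulr_ge0.
  rewrite [leRHS](_ : _ = C * n ^+ 3 * C + C * (C * n ^+ 3) + C ^+ 2 * n ^+ 3 + C * n * (C * n ^+ 2)
    + C * n ^+ 2 * (C * n) + C ^+ 2 * n ^+ 3 + C ^+ 2 * n ^+ 3); last by ring.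
  rewrite -[leLHS]addr0 lerD //; last by rewrite mulr_ge0.
  apply: le_trans (ler_normD _ _) _; apply: lerD; last exact: le_trans e1.
  do 2!(apply: le_trans (ler_normD _ _) _; apply: lerD; last by []).
  rewrite (le_trans (ler_normB _ _)) //; apply: lerD; last exact: le_trans e4.
  by rewrite (le_trans (ler_normD _ _)) // lerD.
have n2 : n <= n ^+ 3 by rewrite -[leLHS]mulr1 exprS ler_wpM2l // exprn_ege1 // ltW.
have n3 : n ^+ 2 <= n ^+ 3 by rewrite [n ^+ 3]exprS ler_peMl ?sqr_ge0 // ltW.
have n4 : 1 <= n ^+ 3 by rewrite exprn_ege1 // ltW.
have h1 := ler_norm_mul f'C g'C; have h2 := ler_norm_mul fC gC.
have h3 := ler_norm_mul fC L2C; have h4 := ler_norm_mul gC L1C.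
have h5 := ler_norm_mul fC Q2C; have h6 := ler_norm_mul gC Q1C.
have h7 := ler_norm_mul L1C L2C.
apply: (@le_trans _ _ (C * C + C * C + (C * (C * n) + C * (C * n)) + (C * (C * n ^+ 2) + C * (C * n ^+ 2) + C * n * (C * n)))).
  do 2!(rewrite (le_trans (ler_normB _ _)) //; apply: lerD;
    last by do ?(rewrite (le_trans (ler_normD _ _)) //; apply: lerD => //)).
  by rewrite (le_trans (ler_normB _ _)) // lerD.
rewrite [leLHS](_ : _ = C ^+ 2 * (2 + 2 * n + 3 * n ^+ 2)); last by ring.
by rewrite [7 * _]mulrC -[leRHS]mulrA ler_wpM2l //; lra.
Qed.

Lemma smooth2M F G : smooth2 F -> smooth2 G -> smooth2 (fun x => F x * G x).
Proof.
move=> [C1 [A1 [Q1 [C10 H1]]]] [C2 [A2 [Q2 [C20 H2]]]].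
pose C := C1 + C2; have C0 : 0 <= C by rewrite addr_ge0.
have {}H1 : taylor2 C F A1 Q1 by apply: taylor2_le H1; rewrite lerDl.
have {}H2 : taylor2 C G A2 Q2 by apply: taylor2_le H2; rewrite lerDr.
exists (7 * C ^+ 2), (fun x i => F x * A2 x i + G x * A1 x i),
  (fun x i j => F x * Q2 x i j + G x * Q1 x i j + A1 x i * A2 x j).
have CC := sqr_ge0 C; split; first by rewrite mulr_ge0.
move=> x; have [h1 h2 h3 h4] := H1 x.
have [g1 g2 g3 g4] := H2 x.
have le7 (y : R) k : y <= C * C *+ k -> (k <= 7)%N -> y <= 7 * C ^+ 2.
  move=> yk k7; apply: le_trans yk _; rewrite -expr2 -mulr_natl ler_wpM2r // ler_nat //.
split=> [|i|i j|b].
- by apply: (le7 _ 1%N) => //; apply: ler_norm_mul.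
- apply: (le7 _ 2%N) => //; rewrite (le_trans (ler_normD _ _)) // mulr2n.
  by apply: lerD; apply: ler_norm_mul.
- apply: (le7 _ 3%N) => //; rewrite (le_trans (ler_normD _ _)) // mulrSr mulr2n.
  by apply: lerD; rewrite ?(le_trans (ler_normD _ _)) ?lerD //; apply: ler_norm_mul.
have -> : \sum_i (F x * A2 x i + G x * A1 x i) * b i =
   F x * (\sum_i A2 x i * b i) + G x * (\sum_i A1 x i * b i).
  by rewrite !mulr_sumr -big_split; apply: eq_bigr => i _ /=; ring.
have -> : \sum_i \sum_j (F x * Q2 x i j + G x * Q1 x i j + A1 x i * A2 x j) * (b i * b j) =
   F x * (\sum_i \sum_j Q2 x i j * (b i * b j)) + G x * (\sum_i \sum_j Q1 x i j * (b i * b j))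
   + (\sum_i A1 x i * b i) * (\sum_i A2 x i * b i).
  rewrite mulr_suml !mulr_sumr -!big_split; apply: eq_bigr => i _ /=.
  by rewrite !mulr_sumr -!big_split; apply: eq_bigr => j _ /=; ring.
have h1' : `|F (vadd x b)| <= C by have [] := H1 (vadd x b).
have h2' : `|G (vadd x b)| <= C by have [] := H2 (vadd x b).
by apply: taylor2_product; rewrite ?norm1_ge0 //; (apply: linear_le || apply: quadratic_le).
Qed.

Lemma smooth2_cst (c : R) : smooth2 (fun=> c).
Proof.
exists `|c|, (fun _ _ => 0), (fun _ _ _ => 0); split=> // x; split=> [|i|i j|b]; rewrite ?normr0 //.
rewrite big1 ?big1 => [|i _|i _]; rewrite ?mul0r //; last by rewrite big1 // => j _; rewrite mul0r.
by rewrite !subr0 subrr normr0 mulr_ge0 // exprn_ge0 // norm1_ge0.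
Qed.

Lemma smooth2_prod (J : Type) (r : seq J) (h : J -> (I -> R) -> R) :
  (forall j, smooth2 (h j)) -> smooth2 (fun x => \prod_(j <- r) h j x).
Proof.
move=> hs; elim: r => [|j r IH].
  by under [X in smooth2 X]funext => x do rewrite big_nil; exact: smooth2_cst.
by under [X in smooth2 X]funext => x do rewrite big_cons; exact: smooth2M.
Qed.

Lemma vaddAC x b c : vadd (vadd x b) c = vadd (vadd x c) b.
Proof. by apply: funext => i; rewrite /vadd addrAC. Qed.

(** Averaging over random translations keeps the constant [C], so the replacement error does not
    deteriorate along the walk. *)
Lemma taylor2_mean C F A Q n (z : seq sign -> I -> R) : taylor2 C F A Q ->
  taylor2 C (fun x => Ex n (fun s => F (vadd x (z s))))
    (fun x i => Ex n (fun s => A (vadd x (z s)) i))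
    (fun x i j => Ex n (fun s => Q (vadd x (z s)) i j)).
Proof.
move=> H x.
have bound (f : seq sign -> R) c : (forall s, `|f s| <= c) -> `|Ex n f| <= c.
  by move=> fc; apply: le_trans (ler_norm_Ex _ _) _; rewrite -[leRHS](Ex_cst n) Ex_le.
split=> [|i|i j|b]; try by apply: bound => s; have [h1 h2 h3 h4] := H (vadd x (z s)).
have -> : Ex n (fun s => F (vadd (vadd x b) (z s))) - Ex n (fun s => F (vadd x (z s)))
  - \sum_i Ex n (fun s => A (vadd x (z s)) i) * b i
  - \sum_i \sum_j Ex n (fun s => Q (vadd x (z s)) i j) * (b i * b j)
  = Ex n (fun s => F (vadd (vadd x (z s)) b) - F (vadd x (z s))
    - \sum_i A (vadd x (z s)) i * b i - \sum_i \sum_j Q (vadd x (z s)) i j * (b i * b j)).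
  rewrite !ExB !Ex_sum; congr (_ - _ - _ - _).
  - by apply: eq_Ex => s _; rewrite vaddAC.
  - by apply: eq_bigr => i _; rewrite ExZr.
  - by apply: eq_bigr => i _; rewrite Ex_sum; apply: eq_bigr => j _; rewrite ExZr.
by apply: bound => s; have [h1 h2 h3 h4] := H (vadd x (z s)).
Qed.

Lemma taylor2_centered C F A Q n (z : seq sign -> I -> R) x : taylor2 C F A Q ->
  (forall i, Ex n (z ^~ i) = 0) ->
  `|Ex n (fun s => F (vadd x (z s))) - F x -
    \sum_i \sum_j Q x i j * Ex n (fun s => z s i * z s j)|
  <= C * Ex n (fun s => norm1 (z s) ^+ 3).
Proof.
move=> H z0; have [_ _ _ h4] := H x.
have -> : Ex n (fun s => F (vadd x (z s))) - F x -
    \sum_i \sum_j Q x i j * Ex n (fun s => z s i * z s j) =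
  Ex n (fun s => F (vadd x (z s)) - F x - \sum_i A x i * z s i
     - \sum_i \sum_j Q x i j * (z s i * z s j)).
  rewrite !ExB !Ex_sum Ex_cst; congr (_ - _).
    rewrite [X in _ = _ - X]big1 ?subr0 // => i _.
    by rewrite ExZ z0 mulr0.
  by apply: eq_bigr => i _; rewrite Ex_sum; apply: eq_bigr => j _; rewrite ExZ.
by apply: le_trans (ler_norm_Ex _ _) _; rewrite -ExZ; apply: Ex_le => s _; exact: h4.
Qed.

(** Nested expectations, each step reading [n] fresh signs, allow one step to be replaced at a time;
    [walkE] recovers a single expectation over the concatenated blocks. *)
Fixpoint walk n (z : nat -> seq sign -> I -> R) j p F x : R :=
  if p is p'.+1 then Ex n (fun s => walk n z j.+1 p' F (vadd x (z j s))) else F x.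

Lemma taylor2_walk C F A Q n z j p : taylor2 C F A Q ->
  exists A' Q', taylor2 C (walk n z j p F) A' Q'.
Proof.
move=> H; elim: p j => [|p IH] j; first by exists A, Q.
have [A' [Q' H']] := IH j.+1.
by eexists; eexists; exact: (taylor2_mean n (z j) H').
Qed.

(** The steps after [j] are replaced under the expectation; step [j] is then exchanged below the
    mean [G] of the replaced ones, which has the same constant [C]. Centering kills the gradients,
    the Hessian terms differ by [kap], and each of the two Taylor remainders costs [tau]. *)
Lemma lindeberg C F A Q n n' (z z' : nat -> seq sign -> I -> R) (kap tau : R) j p x :
  0 <= C -> taylor2 C F A Q ->
  (forall l i, Ex n (z l ^~ i) = 0) -> (forall l i, Ex n' (z' l ^~ i) = 0) ->
  (forall l i i', `|Ex n (fun s => z l s i * z l s i') - Ex n' (fun s => z' l s i * z' l s i')| <= kap) ->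
  (forall l, Ex n (fun s => norm1 (z l s) ^+ 3) <= tau) ->
  (forall l, Ex n' (fun s => norm1 (z' l s) ^+ 3) <= tau) ->
  `|walk n z j p F x - walk n' z' j p F x| <= p%:R * (C * (#|I|%:R ^+ 2 * kap + 2 * tau)).
Proof.
move=> C0 H zE zE' zz zt zt'; set eps := C * _.
elim: p j x => [|p IH] j x /=; first by rewrite subrr normr0 mul0r.
have [A' [Q' H']] := taylor2_walk n' z' j.+1 p H.
set G := walk n' z' j.+1 p F in H' *.
rewrite -[p.+1%:R]natr1 mulrDl mul1r.
rewrite -(subrK (Ex n (fun s => G (vadd x (z j s)))) (Ex n _)) -[X in `|X|]addrA.
rewrite (le_trans (ler_normD _ _)) //; apply: lerD.
  rewrite -ExB; apply: le_trans (ler_norm_Ex _ _) _.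
  by rewrite -[leRHS](Ex_cst n); apply: Ex_le => s _; exact: IH.
have h := taylor2_centered x H' (zE j); have h' := taylor2_centered x H' (zE' j).
have [_ _ Qb _] := H' x.
have hq : `|\sum_i \sum_l Q' x i l * Ex n (fun s => z j s i * z j s l) -
   \sum_i \sum_l Q' x i l * Ex n' (fun s => z' j s i * z' j s l)| <= C * (#|I|%:R ^+ 2 * kap).
  rewrite -sumrB; apply: le_trans (ler_norm_sum _ _ _) _.
  have -> : C * (#|I|%:R ^+ 2 * kap) = \sum_(i : I) \sum_(l : I) C * kap.
    by rewrite !sumr_const -[RHS]mulr_natl -[(C * kap) *+ _]mulr_natl; ring.
  apply: ler_sum => i _; rewrite -sumrB; apply: le_trans (ler_norm_sum _ _ _) _.
  by apply: ler_sum => l _; rewrite -mulrBr; apply: ler_norm_mul.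
have ht := ler_wpM2l C0 (zt j); have ht' := ler_wpM2l C0 (zt' j).
rewrite /eps mulrDr; move: h h' hq; set e := Ex n _; set e' := Ex n' _.
set q := \sum_i _; set q' := \sum_i _ => h h' hq.
rewrite [X in `|X|](_ : _ = (e - G x - q) - (e' - G x - q') + (q - q')); last by ring.
rewrite (le_trans (ler_normD _ _)) // addrC lerD //.
by rewrite (le_trans (ler_normB _ _)) //; move: h h' ht ht'; lra.
Qed.

Lemma walkE n z j p F x : walk n z j p F x =
  Ex (p * n) (fun s => F (fun i => x i + \sum_(l < p) z (j + l)%N (take n (drop (l * n) s)) i)).
Proof.
elim: p j x => [|p IH] j x /=.
  by congr F; apply: funext => i; rewrite big_ord0 addr0.
rewrite mulSn Ex_cat; apply: eq_Ex => s sn; rewrite IH.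
apply: eq_Ex => t _; congr F; apply: funext => i.
rewrite /vadd big_ord_recl /= mul0n drop0 addn0 take_size_cat // addrA; congr (_ + _).
apply: eq_bigr => l _; rewrite /bump /= add1n addSnnS mulSn [(n + _)%N]addnC -drop_drop.
by rewrite drop_size_cat.
Qed.

End Lindeberg.

(** * Smooth cutoffs *)

Section Cutoff.
Variable R : realType.
Implicit Types (x b t e : R).

Definition pospart x : R := Num.max x 0.

Lemma pospart_taylor x b :
  `|pospart (x + b) ^+ 3 - pospart x ^+ 3 - 3 * pospart x ^+ 2 * b - 3 * pospart x * b ^+ 2|
  <= `|b| ^+ 3.
Proof.
rewrite /pospart; have [x0|x0] := leP x 0; have [xb0|xb0] := leP (x + b) 0.
- by rewrite !expr0n /= !mulr0 !mul0r !subr0 normr0 exprn_ge0.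
- rewrite !expr0n /= !mulr0 !mul0r !subr0 normrX lerXn2r ?nnegrE //.
  by rewrite !ger0_norm; lra.
- have [c bE] : exists c, b = - c by exists (- b); rewrite opprK.
  rewrite {}bE in xb0 *; have xc : 0 <= c - x by lra.
  have cx : (c - x) ^+ 3 <= c ^+ 3 by rewrite lerXn2r ?nnegrE; lra.
  have cx0 : 0 <= (c - x) ^+ 3 by rewrite exprn_ge0.
  rewrite normrN (ger0_norm (_ : 0 <= c)); last by lra.
  rewrite expr0n /= [X in `|X|](_ : _ = (c - x) ^+ 3 - c ^+ 3); last by ring.
  by rewrite distrC ger0_norm; lra.
- by rewrite [X in `|X|](_ : _ = b ^+ 3) ?normrX //; ring.
Qed.

(* The third difference of the truncated cubic: a C^2 spline equal to 1 on
   ]-oo, 0] and to 0 on [3, +oo[. *)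
Definition third_diff (f : R -> R) x := f x - 3 * f (x - 1) + 3 * f (x - 2) - f (x - 3).
Definition spline x := 1 - third_diff (fun y => pospart y ^+ 3) x / 6.
Definition spline1 x := - third_diff (fun y => 3 * pospart y ^+ 2) x / 6.
(** Half the second derivative of [spline], as [Q] is half a Hessian in [taylor2]. *)
Definition spline2 x := - third_diff (fun y => 3 * pospart y) x / 6.

Lemma pospart0 x : x <= 0 -> pospart x = 0. Proof. by move=> x0; exact/max_idPr. Qed.
Lemma pospart_id x : 0 <= x -> pospart x = x. Proof. by move=> x0; exact/max_idPl. Qed.

Lemma spline_le0 x : x <= 0 -> spline x = 1.
Proof. by move=> x0; rewrite /spline /third_diff !pospart0; lra. Qed.

Lemma spline_ge3 x : 3 <= x -> spline x = 0.
Proof.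
move=> x3; rewrite /spline /third_diff !pospart_id; try lra; by field.
Qed.

Lemma spline_bounds x : [/\ 0 <= spline x <= 1, `|spline1 x| <= 1 & `|spline2 x| <= 1].
Proof.
(* Polynomial inequalities on [[0, 1]]: translation, or reflection for the last one, brings each of
   the three pieces of the spline there. *)
have pow3 (y : R) : 0 <= y -> y <= 1 -> [/\ 0 <= y ^+ 3, y ^+ 3 <= y ^+ 2, y ^+ 2 <= y,
    3 * y ^+ 2 <= 1 + 2 * y ^+ 3 & y - y ^+ 2 <= 1 / 4].
  move=> y0 y1; have y2 := sqr_ge0 y; rewrite exprn_ge0 // [y ^+ 3]exprS ler_piMl //=.
  split=> //; first by rewrite expr2 ler_piMl.
    have : 0 <= (1 + 2 * y) * (1 - y) ^+ 2 by rewrite mulr_ge0 ?sqr_ge0 //; lra.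
    by rewrite [(1 - y) ^+ 2]expr2 expr2; lra.
  by have := sqr_ge0 (2 * y - 1); rewrite !expr2; lra.
have [x0|x0] := leP x 0.
  rewrite spline_le0 // /spline1 /spline2 /third_diff !pospart0; try lra.
  by rewrite !expr0n /= !mulr0 !subr0 !addr0 !oppr0 !mul0r !normr0 ler01 lexx; split.
have [x1|x1] := leP x 1.
  have [? ? ? ? ?] := pow3 x (ltW x0) x1.
  have p0 := pospart_id (ltW x0); have p1 : pospart (x - 1) = 0 by apply: pospart0; lra.
  have p2 : pospart (x - 2) = 0 by apply: pospart0; lra.
  have p3 : pospart (x - 3) = 0 by apply: pospart0; lra.
  rewrite /spline /spline1 /spline2 /third_diff p0 p1 p2 p3.
  by rewrite !expr0n /= !ler_norml; split; [apply/andP|apply/andP|apply/andP]; split; lra.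
have [x2|x2] := leP x 2.
  have [||? ? ? ? ?] := pow3 (x - 1); [lra|lra|].
  have p0 := pospart_id (ltW x0); have p1 : pospart (x - 1) = x - 1 by apply: pospart_id; lra.
  have p2 : pospart (x - 2) = 0 by apply: pospart0; lra.
  have p3 : pospart (x - 3) = 0 by apply: pospart0; lra.
  rewrite /spline /spline1 /spline2 /third_diff p0 p1 p2 p3.
  have -> : x ^+ 3 = 1 + 3 * (x - 1) + 3 * (x - 1) ^+ 2 + (x - 1) ^+ 3 by ring.
  have -> : x ^+ 2 = 1 + 2 * (x - 1) + (x - 1) ^+ 2 by ring.
  by rewrite !expr0n /= !ler_norml; split; [apply/andP|apply/andP|apply/andP]; split; lra.
have [x3|x3] := leP x 3.
  have [y xE] : exists y, x = 3 - y by exists (3 - x); ring.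
  rewrite {}xE in x0 x1 x2 x3 *; have [||? ? ? ? ?] := pow3 y; [lra|lra|].
  have p0 := pospart_id (ltW x0); have p1 : pospart (3 - y - 1) = 3 - y - 1 by apply: pospart_id; lra.
  have p2 : pospart (3 - y - 2) = 3 - y - 2 by apply: pospart_id; lra.
  have p3 : pospart (3 - y - 3) = 0 by apply: pospart0; lra.
  rewrite /spline /spline1 /spline2 /third_diff p0 p1 p2 p3.
  by rewrite !expr0n /= !ler_norml; split; [apply/andP|apply/andP|apply/andP]; split; lra.
rewrite spline_ge3 ?(ltW x3) // /spline1 /spline2 /third_diff !pospart_id; try lra.
split; rewrite ?lexx ?ler01 //.
  by rewrite [X in `|X|](_ : _ = 0) ?normr0 ?ler01 //; field.
by rewrite [X in `|X|](_ : _ = 0) ?normr0 ?ler01 //; field.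
Qed.

Lemma spline_taylor x b :
  `|spline (x + b) - spline x - spline1 x * b - spline2 x * b ^+ 2| <= 2 * `|b| ^+ 3.
Proof.
pose T y := pospart (y + b) ^+ 3 - pospart y ^+ 3 - 3 * pospart y ^+ 2 * b - 3 * pospart y * b ^+ 2.
(* Four cubic remainders with weights 1, 3, 3, 1, divided by 6: the constant [8 / 6] is rounded up
   to 2. *)
rewrite [X in `|X|](_ : _ = - (T x - 3 * T (x - 1) + 3 * T (x - 2) - T (x - 3)) / 6); last first.
  rewrite /spline /spline1 /spline2 /third_diff /T.
  by rewrite !(addrAC x _ b); field.
have H y : - `|b| ^+ 3 <= T y <= `|b| ^+ 3 by rewrite -ler_norml pospart_taylor.
move: (H x) (H (x - 1)) (H (x - 2)) (H (x - 3)); rewrite ler_norml.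
by move=> /andP[? ?] /andP[? ?] /andP[? ?] /andP[? ?]; apply/andP; split; lra.
Qed.

Variable I : finType.

Lemma smooth2_spline (i : I) (sg t e : R) : sg ^+ 2 = 1 -> 0 < e ->
  smooth2 (fun v : I -> R => spline ((sg * v i - t) / e)).
Proof.
move=> sg1 e0; have sgn : `|sg| = 1.
  by apply/eqP; rewrite -(@eqrXn2 _ 2) // real_normK ?num_real // sg1 expr1n.
pose d := e^-1; have d0 : 0 < d by rewrite invr_gt0.
have dn : `|d| = d by rewrite gtr0_norm.
pose C := 2 * (1 + d + d ^+ 2 + d ^+ 3).
have d2 := sqr_ge0 d; have d3 : 0 <= d ^+ 3 by rewrite exprn_ge0 // ltW.
have C0 : 0 <= C by rewrite mulr_ge0 // !addr_ge0 // ltW.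
exists C, (fun v j => (j == i)%:R * (spline1 ((sg * v i - t) / e) * (sg * d))),
  (fun v j l => ((j == i) && (l == i))%:R * (spline2 ((sg * v i - t) / e) * d ^+ 2)).
split=> // v; set x := (sg * v i - t) / e.
have [/andP[h0 h1] g1 g2] := spline_bounds x.
have ind (c : bool) (y : R) : 0 <= y -> y <= C -> c%:R * y <= C.
  by case: c => y0 yC; rewrite ?mul1r ?mul0r.
split=> [|j|j l|b].
- by rewrite ger0_norm // /C; lra.
- rewrite normrM normr_nat ind //.
  move: (spline1 x) g1 => y y1; rewrite !normrM dn sgn mul1r.
  by apply: (@le_trans _ _ d); [rewrite ler_piMl // ltW | rewrite /C; lra].
- rewrite normrM normr_nat ind //.
  move: (spline2 x) g2 => y y1; rewrite normrM normrX dn.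
  by apply: (@le_trans _ _ (d ^+ 2)); [rewrite ler_piMl | rewrite /C; lra].
rewrite (bigD1 i) //= eqxx mul1r big1 => [|j /negbTE ->]; last by rewrite mul0r mul0r.
rewrite (bigD1 i) //= (bigD1 i) //= eqxx mul1r big1 => [|j /negbTE ->]; last by rewrite mul0r mul0r.
rewrite big1 => [|j /negbTE ->]; last by rewrite big1 // => l _; rewrite mul0r mul0r.
rewrite !addr0; pose b' := sg * b i / e.
rewrite [X in `|X|](_ : _ = spline (x + b') - spline x - spline1 x * b' - spline2 x * b' ^+ 2).
  apply: le_trans (spline_taylor _ _) _.
  have -> : `|b'| ^+ 3 = `|b i| ^+ 3 * d ^+ 3 by rewrite /b' !normrM sgn mul1r -/d dn exprMn.
  have bi : `|b i| ^+ 3 <= norm1 b ^+ 3 by rewrite lerXn2r ?nnegrE ?norm1_ge0 ?ler_norm1.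
  apply: (@le_trans _ _ (C * `|b i| ^+ 3)); last by rewrite ler_wpM2l.
  by rewrite [leLHS](_ : _ = 2 * d ^+ 3 * `|b i| ^+ 3); [rewrite ler_wpM2r // /C; lra | ring].
have -> : (sg * vadd v b i - t) / e = x + b' by rewrite /vadd /x /b' mulrDr; ring.
rewrite /b' [(_ / e) ^+ 2]expr_div_n exprMn sg1 mul1r /d expr2; congr (_ - _ - _ - _).
  by ring.
by field; rewrite ?lt0r_neq0.
Qed.

(** A smooth substitute for the indicator of the box where all [|v i| <= t]; one factor for each
    sign avoids the kink of the absolute value. *)
Definition box_cutoff (t e : R) (v : I -> R) : R :=
  \prod_i (spline ((1 * v i - t) / e) * spline ((-1 * v i - t) / e)).

Lemma smooth2_box t e : 0 < e -> smooth2 (box_cutoff t e).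
Proof.
move=> e0; apply: smooth2_prod => i.
by apply: smooth2M; apply: smooth2_spline; rewrite ?sqrrN ?expr1n.
Qed.

Lemma box_cutoff_ge0 t e v : 0 <= box_cutoff t e v.
Proof.
apply: prodr_ge0 => i _.
by apply: mulr_ge0; [have [/andP[]] := spline_bounds ((1 * v i - t) / e)
  | have [/andP[]] := spline_bounds ((-1 * v i - t) / e)].
Qed.

Lemma box_cutoff_le1 t e v : box_cutoff t e v <= 1.
Proof.
apply: prodr_ile1 => i _.
have [/andP[h0 h1] _ _] := spline_bounds ((1 * v i - t) / e).
have [/andP[h0' h1'] _ _] := spline_bounds ((-1 * v i - t) / e).
by rewrite mulr_ge0 //= mulr_ile1.
Qed.

Lemma box_cutoff1 t e v : 0 < e -> (forall i, `|v i| <= t) -> box_cutoff t e v = 1.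
Proof.
move=> e0 vt; rewrite /box_cutoff big1 // => i _.
have := vt i; rewrite ler_norml => /andP[h1 h2].
rewrite !spline_le0 ?mulr1 // ler_pdivrMr // mul0r; lra.
Qed.

Lemma box_cutoff0 t e v i : 0 < e -> t + 3 * e < `|v i| -> box_cutoff t e v = 0.
Proof.
move=> e0 vt; rewrite /box_cutoff (bigD1 i) //=.
move: vt; have [v0|v0] := leP 0 (v i) => vt.
  by rewrite ger0_norm // in vt; rewrite spline_ge3 ?mul0r // ler_pdivlMr //; lra.
by rewrite ltr0_norm // in vt; rewrite [X in _ * X * _]spline_ge3 ?mulr0 ?mul0r // ler_pdivlMr //; lra.
Qed.

End Cutoff.

(** * Block decomposition *)

Section Blocks.
Variable R : realType.
Implicit Types (X Y s : seq sign).
Local Notation disc := (disc R).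
Local Notation prob := (prob R).
Local Notation Pr := (Pr R).

(** Omitting the last [K] positions of each block keeps the windows of patterns of length at most
    [K] inside it, so that the summands are independent. *)
Definition block_sum K b T X s : R :=
  \sum_(j < T) disc X (take b (drop (j * b) s)) (b - K).

Lemma block_sum_approx K b T X s : (size X <= K)%N -> (K <= b)%N ->
  `|disc X s (T * b) - block_sum K b T X s| <= (T * K)%:R.
Proof.
move=> XK Kb; elim: T => [|T IH].
  by rewrite mul0n disc0 /block_sum big_ord0 subrr normr0.
rewrite mulSn addnC discD /block_sum big_ord_recr /= -/(block_sum K b T X s).
set u := drop (T * b) s.
have -> : disc X u b = disc X (take b u) (b - K) + disc X (drop (b - K) u) K.
  by rewrite disc_take ?(leq_trans (leq_add (leqnn _) XK)) ?subnK // -discD subnK.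
rewrite [X in `|X|](_ : _ = (disc X s (T * b) - block_sum K b T X s) + disc X (drop (b - K) u) K); last by ring.
rewrite mulSn addnC natrD (le_trans (ler_normD _ _)) // lerD //.
exact: ler_norm_disc.
Qed.

Lemma block_sum_take K b T P X s : (T <= P)%N ->
  block_sum K b T X (take (P * b) s) = block_sum K b T X s.
Proof.
move=> TP; apply: eq_bigr => j _; have jT := ltn_ord j; congr (disc X _ _).
have jP : (j * b + b <= P * b)%N by rewrite addnC -mulSn leq_mul2r (leq_trans jT) ?orbT.
have -> : drop (j * b) (take (P * b) s) = take (P * b - j * b) (drop (j * b) s).
  by rewrite take_drop subnK // (leq_trans _ jP) // leq_addr.
by rewrite take_takel // leq_subRL // (leq_trans _ jP) // leq_addr.
Qed.

(** There are two scales: the walks are observed at [L] times only, and each interval between them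
    is cut into [q] blocks. [L] governs the oscillation between observations, [q] the replacement
    error. *)
Definition block_vec K L q b (c : R) s (i : K.-bseq sign * 'I_L) : R :=
  block_sum K b (i.2.+1 * q) i.1 s / c.

(** Block [j] enters exactly the coordinates whose observation time comes after it, so the values at
    the [L] times form a single vector walk with independent steps. *)
Definition block_step K L q b (c : R) (j : nat) s (i : K.-bseq sign * 'I_L) : R :=
  (j < i.2.+1 * q)%N%:R * disc i.1 s (b - K) / c.

Lemma walk_block_step K L q b c (F : (K.-bseq sign * 'I_L -> R) -> R) :
  walk b (@block_step K L q b c) 0 (L * q) F (fun=> 0) =
  Ex (L * q * b) (fun s => F (@block_vec K L q b c s)).
Proof.
rewrite walkE; apply: eq_Ex => s _; congr F; apply: funext => i.
rewrite add0r /block_step /block_vec /block_sum -mulr_suml; congr (_ / c).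
have iL : (i.2.+1 * q <= L * q)%N by rewrite leq_mul2r ltn_ord orbT.
rewrite (big_ord_widen _ (fun j => disc i.1 (take b (drop (j * b) s)) (b - K)) iL) [RHS]big_mkcond /=.
by apply: eq_bigr => j _; rewrite add0n; case: ifP; rewrite ?mul1r ?mul0r.
Qed.

Lemma normality_le_block_vec K L q b N (t e : R) s :
  0 <= t -> (0 < N)%N -> (2 ^ K <= N)%N -> (0 < q)%N -> (K <= b)%N -> (L * q * b <= N)%N ->
  (L * q * K + K)%:R <= e * Num.sqrt N%:R ->
  normality_le N (t * Num.sqrt N%:R) s ->
  forall i, `|@block_vec K L q b (Num.sqrt N%:R) s i| <= t + e.
Proof.
move=> t0 N0 KN q0 Kb LN eN Hs i; have sN : 0 < Num.sqrt N%:R :> R by rewrite sqrtr_gt0 ltr0n.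
rewrite normrM [X in _ * X]gtr0_norm ?invr_gt0 // ler_pdivrMr // mulrDl.
set T := (i.2.+1 * q)%N; set X : seq sign := i.1; have XK : (size X <= K)%N by apply: size_bseq.
have TL : (T <= L * q)%N by rewrite leq_mul2r ltn_ord orbT.
have T0 : (0 < T)%N by rewrite muln_gt0.
have KT : (K <= T * b)%N by rewrite (leq_trans Kb) // leq_pmull.
(* At time [T * b] itself the window may leave the sequence, hence the retreat by [K], which costs
   another [K]. *)
have dT : `|disc X s (T * b - K)| <= t * Num.sqrt N%:R.
  have [X0|X0] := posnP (size X).
    by rewrite (size0nil X0) disc_nil normr0 mulr_ge0 // ltW.
  apply: Hs => //; first by rewrite (leq_trans _ KN) // leq_exp2l.
  rewrite (leq_trans (leq_add (leqnn _) XK)) // subnK // leqW // (leq_trans _ LN) //.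
  by rewrite leq_mul2r TL orbT.
have := block_sum_approx T s XK Kb; have := ler_norm_disc R X (drop (T * b - K) s) K.
have dS : disc X s (T * b) = disc X s (T * b - K) + disc X (drop (T * b - K) s) K.
  by rewrite -discD subnK.
move: dT; rewrite dS !ler_norml => /andP[? ?] /andP[? ?] /andP[? ?].
have : (T * K)%:R + K%:R <= e * Num.sqrt N%:R.
  by rewrite -natrD (le_trans _ eN) // ler_nat leq_add2r leq_mul2r TL orbT.
by move=> ?; apply/andP; split; lra.
Qed.

Definition oscillates K L a m N (lam : R) s :=
  exists2 i : K.-bseq sign * 'I_L, i \in index_enum _ & exists M,
   [/\ (M <= m)%N, (M + size i.1 <= (N - i.2 * a).+1)%N &
      lam < `|disc i.1 (drop (i.2 * a) s) M|].

(** The discrepancy at [M] is its value at the last observation time, within [e] of a coordinate,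
    plus a move of at most [e] since then. There are [L.+1] starting times because time 0 counts;
    the extra [L * q] in the interval length covers the remainder of [N] modulo [L * q]. *)
Lemma block_vec_normality_le K L q b N (t t' e : R) s : 0 <= t ->
  (0 < N)%N -> (0 < L)%N -> (0 < q)%N -> (0 < b)%N -> (K <= b)%N -> (L * q * b <= N < L * q * b.+1)%N ->
  (L * q * K)%:R <= e * Num.sqrt N%:R -> 0 <= e -> t + 2 * e <= t' ->
  (forall i, `|@block_vec K L q b (Num.sqrt N%:R) s i| <= t) ->
  ~ oscillates K L.+1 (q * b) (q * b + L * q) N (e * Num.sqrt N%:R) s ->
  ~ long_pattern_deviates K N (t' * Num.sqrt N%:R) s ->
  normality_le N (t' * Num.sqrt N%:R) s.
Proof.
move=> t0 N0 L0 q0 b0 Kb /andP[LN NL] eN e0 tt' Hv Hosc Hlong X M X0 XN MN.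
have sN : 0 < Num.sqrt N%:R :> R by rewrite sqrtr_gt0 ltr0n.
have [XK|KX] := leqP (size X) K; last first.
  by rewrite leNgt; apply/negP => HX; apply: Hlong; exists X, M.
set a := (q * b)%N in Hosc; have a0 : (0 < a)%N by rewrite muln_gt0 q0.
pose l := minn L (M %/ a); have lL : (l < L.+1)%N by rewrite ltnS geq_minl.
have lM : (l * a <= M)%N by rewrite (leq_trans _ (leq_divM M a)) // leq_mul2r geq_minr orbT.
have Mm : (M - l * a <= a + L * q)%N.
  have [LM|ML] := leqP L (M %/ a); rewrite /l ?(minn_idPl LM) ?(minn_idPr (ltnW ML)).
    have : (L * a <= M)%N by rewrite -leq_divRL.
    move: MN NL; rewrite mulnS mulnAC -mulnA [(b * q)%N]mulnC -/a.
    by move: (L * a)%N (L * q)%N => x y; lia.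
  have := ltn_mod M a; rewrite a0 [in (M - _)%N](divn_eq M a).
  by move: (M %% a)%N (_ * a)%N => x y; lia.
have d2 : `|disc X (drop (l * a) s) (M - l * a)| <= e * Num.sqrt N%:R.
  rewrite leNgt; apply/negP => HX; apply: Hosc; exists (Bseq XK, Ordinal lL).
    exact: mem_index_enum.
  exists (M - l * a)%N; split=> //=; move: lM MN X0; move: (l * a)%N (size X) => y k; lia.
have d1 : `|disc X s (l * a)| <= (t + e) * Num.sqrt N%:R.
  have [->|l0] := posnP l.
    by rewrite mul0n disc0 normr0 mulr_ge0 ?addr_ge0 // ltW.
  have lL' : (l.-1 < L)%N by rewrite prednK // geq_minl.
  have := Hv (Bseq XK, Ordinal lL').
  rewrite normrM [X in _ * X]gtr0_norm ?invr_gt0 // ler_pdivrMr //= prednK //.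
  have := block_sum_approx (l * q) s XK Kb; rewrite -mulnA -/a.
  have : (l * q * K)%:R <= e * Num.sqrt N%:R.
    by rewrite (le_trans _ eN) // ler_nat !leq_mul2r geq_minl !orbT.
  rewrite mulrDl !ler_norml => ? /andP[? ?] /andP[? ?]; apply/andP; split; lra.
have : `|disc X s M| <= (t + 2 * e) * Num.sqrt N%:R.
  rewrite -(subnKC lM) discD (le_trans (ler_normD _ _)) //.
  by move: (lerD d1 d2); rewrite -mulrDl => /le_trans; apply; rewrite ler_wpM2r ?(ltW sN) //; lra.
by move=> /le_trans; apply; rewrite ler_wpM2r // ltW.
Qed.

Lemma quartic_le7 p (m n : nat) : 0 <= p -> p <= 1 -> (m <= n)%N -> (0 < n)%N ->
  quartic p 0 m <= 7 * n%:R ^+ 2 :> R.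
Proof.
move=> p0 p1 mn n0; apply: le_trans (quartic_homo p0 mn) _.
rewrite /quartic !expr0n /= !mulr0 !add0r.
have n1 : 1 <= n%:R :> R by rewrite ler1n.
have h1 : p * n%:R <= n%:R ^+ 2 by rewrite expr2 ler_wpM2r // (le_trans p1).
have h2 : p ^+ 2 * n%:R ^+ 2 <= n%:R ^+ 2 by rewrite ler_piMl ?sqr_ge0 // expr_le1.
by lra.
Qed.

Lemma Pr_oscillates K L a m N (e : R) : 0 < e -> (0 < m)%N -> (0 < N)%N -> (L.-1 * a <= N)%N ->
  Pr N (oscillates K L a m N (e * Num.sqrt N%:R)) <=
  #|{: K.-bseq sign}|%:R * L%:R * (7 * K%:R ^+ 5 * m%:R ^+ 2 / (e ^+ 4 * N%:R ^+ 2)).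
Proof.
move=> e0 m0 N0 LN; have NR : 0 < N%:R :> R by rewrite ltr0n.
have sN : 0 < e * Num.sqrt N%:R :> R by rewrite mulr_gt0 // sqrtr_gt0.
apply: le_trans (Pr_bigU _ _ _ _) _.
rewrite -natrM -[X in (_ * X)%:R](card_ord L) -card_prod mulr_natl -sumr_const.
apply: ler_sum => i _.
have iN : (i.2 * a <= N)%N.
  rewrite (leq_trans _ LN) // leq_mul2r -ltnS prednK ?ltn_ord ?orbT //.
  exact: leq_ltn_trans (ltn_ord i.2).
rewrite (Pr_drop R (fun s => exists M, [/\ (M <= m)%N, (M + size i.1 <= (N - i.2 * a).+1)%N &
      e * Num.sqrt N%:R < `|disc i.1 s M|])) //.
apply: le_trans (Pr_disc _ _ _ sN) _.
rewrite exprMn sqrt_nat4 ler_pM2r ?invr_gt0 ?mulr_gt0 ?exprn_gt0 //.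
rewrite [7 * _]mulrC -[leRHS]mulrA.
have p0 := ltW (prob_gt0 R i.1); have p1 := prob_le1 R i.1.
apply: ler_pM; rewrite ?exprn_ge0 ?quartic_ge0 //; last exact: quartic_le7.
by rewrite lerXn2r ?nnegrE // ler_nat size_bseq.
Qed.

Lemma covariance_bound K : exists2 G : R, 0 <= G & forall X Y, (size X <= K)%N -> (size Y <= K)%N ->
  exists2 gam : R, `|gam| <= G & forall b, (K + K <= b)%N ->
    `|Ex b (fun s => disc X s (b - K) * disc Y s (b - K)) - gam * (b - K)%:R| <= G.
Proof.
pose Q (i : K.-bseq sign * K.-bseq sign) (_ : R) (m : nat) :=
  exists2 gam : R, `|gam| <= m%:R & forall b, (K + K <= b)%N ->
    `|Ex b (fun s => disc i.1 s (b - K) * disc i.2 s (b - K)) - gam * (b - K)%:R| <= m%:R.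
have [|i _|g _ [m H]] := @uniform_threshold R _ (enum [set: K.-bseq sign * K.-bseq sign]) Q.
- move=> i g g' m m' _ _ mm' [gam gm H]; have mR : m%:R <= m'%:R :> R by rewrite ler_nat.
  by exists gam => [|b Kb]; [exact: le_trans mR | exact: le_trans (H b Kb) mR].
- have [gam [beta [b0 H]]] := disc_covariance R (size_bseq i.1) (size_bseq i.2).
  exists 1 => //; exists (Num.Def.archi_bound (`|gam| + beta)).
  have Hm : `|gam| + beta <= (Num.Def.archi_bound (`|gam| + beta))%:R.
    by apply/ltW/archi_boundP; rewrite addr_ge0.
  exists gam => [|b Kb]; first by rewrite (le_trans _ Hm) // lerDl.
  by rewrite (le_trans (H _ _ _ _)) ?(le_trans _ Hm) ?lerDr //; lia.
exists m%:R => // X Y XK YK; apply: (H (Bseq XK, Bseq YK)).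
by rewrite mem_enum inE.
Qed.

Lemma Ex_block_step K L q b c j i : (K <= b)%N ->
  Ex b (fun s => @block_step K L q b c j s i) = 0.
Proof.
move=> Kb; rewrite ExZr ExZ Ex_disc ?mulr0 ?mul0r //.
by rewrite (leq_trans (leq_add (leqnn _) (size_bseq i.1))) // subnK.
Qed.

(** A block of at most [N / r ^ 2] signs moves by about [1 / r]; cutting at that size gives
    [y ^ 3 <= r ^- 3 + r * y ^ 4], and the fourth moment is of order [r ^- 4]. *)
Lemma Ex_norm1_block_step K L q b r N j : (K <= b)%N -> (0 < r)%N -> (0 < N)%N ->
  (r * r * b <= N)%N ->
  Ex b (fun s => norm1 (@block_step K L q b (Num.sqrt N%:R) j s) ^+ 3) <=
  (1 + 7 * K%:R ^+ 5 * #|{: K.-bseq sign * 'I_L}|%:R ^+ 5) / r%:R ^+ 3.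
Proof.
move=> Kb r0 N0 bN; set n := #|_|; pose z := @block_step K L q b (Num.sqrt N%:R); rewrite -/z.
have NR : 0 < N%:R :> R by rewrite ltr0n.
have rR : 0 < r%:R :> R by rewrite ltr0n.
apply: (@le_trans _ _ (Ex b (fun s => 1 / r%:R ^+ 3 + (n%:R ^+ 4 * \sum_i z j s i ^+ 4) * r%:R))).
  apply: Ex_le => s _; set y := norm1 _; have y0 : 0 <= y by exact: norm1_ge0.
  have y4 : y ^+ 4 <= n%:R ^+ 4 * \sum_i z j s i ^+ 4.
    have [n0|n0] := posnP n.
      rewrite /y /norm1 big1 ?expr0n /= ?mulr_ge0 ?exprn_ge0 ?sumr_ge0 // => i _.
        by rewrite exprn_even_ge0.
      by have := max_card (pred1 i); rewrite card1 -/n n0.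
    have [i0 _] : exists i : K.-bseq sign * 'I_L, i \in predT by apply/card_gt0P.
    have [i _ zi] := @Order.TotalTheory.arg_maxP _ _ _ i0 xpredT (fun i => `|z j s i|) isT.
    apply: (@le_trans _ _ (n%:R ^+ 4 * z j s i ^+ 4)); last first.
      rewrite ler_wpM2l ?exprn_ge0 // (bigD1 i) //= lerDl sumr_ge0 // => l _.
      by rewrite exprn_even_ge0.
    rewrite -[z j s i ^+ 4]ger0_norm ?exprn_even_ge0 // normrX -exprMn lerXn2r ?nnegrE ?mulr_ge0 //.
    rewrite /y /norm1 (le_trans (ler_sum _ (fun l _ => zi l isT))) // sumr_const.
    by rewrite mulr_natl.
  apply: (@le_trans _ _ (1 / r%:R ^+ 3 + y ^+ 4 * r%:R)); last first.
    by rewrite lerD2l ler_wpM2r.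
  have [yr|ry] := leP (y * r%:R) 1.
    apply: (@le_trans _ _ (1 / r%:R ^+ 3)); last by rewrite lerDl mulr_ge0 ?exprn_ge0 // ltW.
    by rewrite ler_pdivlMr ?exprn_gt0 // -exprMn exprn_ile1 // mulr_ge0 // ltW.
  apply: (@le_trans _ _ (y ^+ 4 * r%:R)); last by rewrite lerDr divr_ge0 // exprn_ge0 // ltW.
  by rewrite [y ^+ 4]exprSr -mulrA ler_peMr ?exprn_ge0 // ltW.
rewrite ExD Ex_cst ExZr ExZ Ex_sum.
have z4 i : Ex b (fun s => z j s i ^+ 4) <= 7 * K%:R ^+ 5 / r%:R ^+ 4.
  set X : seq sign := i.1; have XK : (size X <= K)%N by apply: size_bseq.
  apply: (@le_trans _ _ (Ex b (fun s => disc X s (b - K) ^+ 4) / N%:R ^+ 2)).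
    rewrite -ExZr; apply: Ex_le => s _; rewrite /z /block_step expr_div_n sqrt_nat4 exprMn.
    rewrite ler_wpM2r ?invr_ge0 ?exprn_ge0 // ler_piMl ?exprn_even_ge0 //.
    by case: (_ < _)%N; rewrite ?expr1n ?expr0n.
  rewrite ler_pdivrMr ?exprn_gt0 //.
  have bX : (b - K + size X <= b.+1)%N.
    by rewrite (leq_trans (leq_add (leqnn _) XK)) // subnK.
  apply: le_trans (Ex_disc4 R bX) _.
  have p0 := ltW (prob_gt0 R X); have p1 := prob_le1 R X.
  have [->|b0] := posnP b.
    rewrite sub0n /quartic !expr0n /= !mulr0 !addr0 mulr0.
    by rewrite mulr_ge0 ?divr_ge0 ?mulr_ge0 ?exprn_ge0.
  apply: (@le_trans _ _ (K%:R ^+ 5 * (7 * b%:R ^+ 2))).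
    apply: ler_pM; rewrite ?exprn_ge0 ?quartic_ge0 //.
      by rewrite lerXn2r ?nnegrE // ler_nat.
    by apply: quartic_le7 => //; apply: leq_subr.
  rewrite [leRHS](_ : _ = K%:R ^+ 5 * (7 * (N%:R ^+ 2 / r%:R ^+ 4))); last by ring.
  rewrite ler_wpM2l ?exprn_ge0 // ler_wpM2l // ler_pdivlMr ?exprn_gt0 //.
  rewrite (exprM _ 2 2) -exprMn lerXn2r ?nnegrE ?mulr_ge0 ?exprn_ge0 //.
  by rewrite mulrC expr2 -!natrM ler_nat.
apply: (@le_trans _ _ (1 / r%:R ^+ 3 + n%:R ^+ 4 * (\sum_(i : K.-bseq sign * 'I_L) 7 * K%:R ^+ 5 / r%:R ^+ 4) * r%:R)).
  by rewrite lerD2l ler_wpM2r // ler_wpM2l ?exprn_ge0 // ler_sum.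
rewrite sumr_const -[_ *+ _]mulr_natl -/n le_eqVlt; apply/orP; left; apply/eqP.
by field; rewrite lt0r_neq0.
Qed.

Lemma divn_ratio (K P N : nat) : (0 < P)%N -> (0 < N)%N -> (K <= N %/ P)%N ->
  `|(N %/ P - K)%:R / N%:R - P%:R^-1| <= K.+1%:R / N%:R :> R.
Proof.
move=> P0 N0 KN; have NR : 0 < N%:R :> R by rewrite ltr0n.
have PR : 0 < P%:R :> R by rewrite ltr0n.
have le1 : (N %/ P * P)%:R <= N%:R :> R by rewrite ler_nat leq_divM.
have lt2 : N%:R <= ((N %/ P).+1 * P)%:R :> R by rewrite ler_nat ltnW // ltn_ceil.
rewrite natrB //; rewrite natrM in le1; rewrite natrM -natr1 in lt2.
rewrite -[K.+1%:R]natr1 -(ler_pM2r NR) divfK ?lt0r_neq0 // -[X in _ * X <= _](ger0_norm (ltW NR)) -normrM.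
rewrite mulrBl divfK ?lt0r_neq0 // mulrC -/(N%:R / P%:R).
have h1 : (N %/ P)%:R <= N%:R / P%:R :> R by rewrite ler_pdivlMr.
have h2 : N%:R / P%:R <= (N %/ P)%:R + 1 :> R by rewrite ler_pdivrMr.
have K0 : 0 <= K%:R :> R by [].
by rewrite ler_norml; apply/andP; split; lra.
Qed.

(** Both covariances are compared with [w * gam / P], which depends on neither length. *)
Lemma block_step_covariance K L q P (G : R) : (0 < P)%N -> 0 <= G ->
  (forall X Y, (size X <= K)%N -> (size Y <= K)%N ->
  exists2 gam : R, `|gam| <= G & forall b, (K + K <= b)%N ->
    `|Ex b (fun s => disc X s (b - K) * disc Y s (b - K)) - gam * (b - K)%:R| <= G) ->
  forall N N' j i i', (P * (K + K) < N)%N -> (P * (K + K) < N')%N ->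
  `|Ex (N %/ P) (fun s => @block_step K L q (N %/ P) (Num.sqrt N%:R) j s i *
                          @block_step K L q (N %/ P) (Num.sqrt N%:R) j s i') -
    Ex (N' %/ P) (fun s => @block_step K L q (N' %/ P) (Num.sqrt N'%:R) j s i *
                           @block_step K L q (N' %/ P) (Num.sqrt N'%:R) j s i')|
  <= G * K.+2%:R * (N%:R^-1 + N'%:R^-1).
Proof.
move=> P0 G0 H N N' j i i' NP NP'.
have [gam gG Hb] := H i.1 i'.1 (size_bseq _) (size_bseq _).
pose w : R := (j < i.2.+1 * q)%N%:R * (j < i'.2.+1 * q)%N%:R.
have w1 : `|w| <= 1.
  by rewrite /w; case: (_ < _)%N; case: (_ < _)%N; rewrite ?mulr0 ?mul0r ?mulr1 ?normr0 ?normr1.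
have main (M : nat) : (P * (K + K) < M)%N ->
  `|Ex (M %/ P) (fun s => @block_step K L q (M %/ P) (Num.sqrt M%:R) j s i *
                          @block_step K L q (M %/ P) (Num.sqrt M%:R) j s i') - w * gam / P%:R|
  <= G * K.+2%:R / M%:R.
  move=> MP; have M0 : (0 < M)%N by exact: leq_ltn_trans MP.
  have MR : 0 < M%:R :> R by rewrite ltr0n.
  have KM : (K + K <= M %/ P)%N by rewrite leq_divRL // mulnC ltnW.
  set b := (M %/ P)%N in KM *.
  have -> : Ex b (fun s => @block_step K L q b (Num.sqrt M%:R) j s i *
                          @block_step K L q b (Num.sqrt M%:R) j s i') =
    w * (Ex b (fun s => disc i.1 s (b - K) * disc i'.1 s (b - K)) / M%:R).
    rewrite -ExZr -ExZ; apply: eq_Ex => s _.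
    have -> : M%:R^-1 = (Num.sqrt M%:R)^-1 * (Num.sqrt M%:R)^-1 :> R.
      by rewrite -invfM -expr2 sqr_sqrt_nat.
    by rewrite /block_step /w; ring.
  rewrite -mulrA -mulrBr normrM; apply: (@le_trans _ _ (1 * (G * K.+2%:R / M%:R))); last by rewrite mul1r.
  apply: ler_pM => //; set a := Ex b _.
  rewrite [X in `|X|](_ : _ = (a - gam * (b - K)%:R) / M%:R + gam * ((b - K)%:R / M%:R - P%:R^-1)); last by ring.
  rewrite (le_trans (ler_normD _ _)) // !normrM.
  rewrite [leRHS](_ : _ = G * `|M%:R^-1| + G * (K.+1%:R / M%:R)).
    apply: lerD; first by rewrite ler_wpM2r // Hb.
    by apply: ler_pM => //; apply: divn_ratio => //; rewrite (leq_trans _ KM) // leq_addr.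
  by rewrite -[K.+2%:R]natr1 gtr0_norm ?invr_gt0 //; ring.
have := main _ NP; have := main _ NP'; rewrite mulrDr !ler_norml.
by move=> /andP[? ?] /andP[? ?]; apply/andP; split; lra.
Qed.

End Blocks.

(** * Asymptotic comparison of the distribution functions *)

Section Comparison.
Variable R : realType.
Implicit Types (X Y s : seq sign).
Local Notation Pr := (Pr R).

Lemma block_vec_take K L q b (c : R) s :
  block_vec q b c (take (L * q * b) s) = block_vec q b c s :> (K.-bseq sign * 'I_L -> R).
Proof.
apply: funext => i; rewrite /block_vec block_sum_take //.
by rewrite leq_mul2r ltn_ord orbT.
Qed.

Lemma Ex_block_vec K L q b N (c : R) (F : (K.-bseq sign * 'I_L -> R) -> R) :
  (L * q * b <= N)%N ->
  Ex (L * q * b) (fun s => F (block_vec q b c s)) = Ex N (fun s => F (block_vec q b c s)).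
Proof.
move=> LN; rewrite -(Ex_take (fun s => F (block_vec q b c s)) LN).
by apply: eq_Ex => s _; rewrite block_vec_take.
Qed.

Lemma normality_cdf_le_cutoff K L q N (t e : R) : let b := (N %/ (L * q))%N in
  0 <= t -> 0 < e -> (0 < N)%N -> (2 ^ K <= N)%N -> (0 < q)%N -> (K <= b)%N ->
  (L * q * K + K)%:R <= e * Num.sqrt N%:R ->
  normality_cdf N t <=
  Ex (L * q * b) (fun s => box_cutoff (t + e) e
    (block_vec q b (Num.sqrt N%:R) s : K.-bseq sign * 'I_L -> R)).
Proof.
move=> b t0 e0 N0 KN q0 Kb eN; have LN : (L * q * b <= N)%N by rewrite mulnC leq_divM.
rewrite (Ex_block_vec _ (box_cutoff (t + e) e) LN); apply: Ex_le => s _.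
case: asboolP => [Hs|_]; last exact: box_cutoff_ge0.
rewrite box_cutoff1 // => i.
exact: normality_le_block_vec eN Hs i.
Qed.

(** Outside the exceptional events, a nonzero cutoff puts all coordinates below [t + e + 3 * e], and
    [block_vec_normality_le] adds [2 * e]; the total stays within [t + 8 * e]. *)
Lemma cutoff_le_normality_cdf K L q N (t e : R) : let b := (N %/ (L * q))%N in
  0 <= t -> 0 < e -> (0 < N)%N -> (0 < L)%N -> (0 < q)%N -> (0 < b)%N -> (K <= b)%N ->
  (L * q * K)%:R <= e * Num.sqrt N%:R ->
  Ex (L * q * b) (fun s => box_cutoff (t + e) e
    (block_vec q b (Num.sqrt N%:R) s : K.-bseq sign * 'I_L -> R)) <=
  normality_cdf N (t + 8 * e) + Pr N (oscillates K L.+1 (q * b) (q * b + L * q) N (e * Num.sqrt N%:R))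
  + Pr N (long_pattern_deviates K N ((t + 8 * e) * Num.sqrt N%:R)).
Proof.
move=> b t0 e0 N0 L0 q0 b0 Kb eN; have LN : (L * q * b <= N)%N by rewrite mulnC leq_divM.
have NL : (N < L * q * b.+1)%N by rewrite mulnC ltn_ceil // muln_gt0 L0.
rewrite (Ex_block_vec _ (box_cutoff (t + e) e) LN) -!ExD; apply: Ex_le => s _.
case: asboolP => [_|nHs]; first by rewrite -addrA (le_trans (box_cutoff_le1 _ _ _)) // lerDl addr_ge0.
case: asboolP => [_|nosc]; first by rewrite add0r (le_trans (box_cutoff_le1 _ _ _)) // lerDl.
case: asboolP => [_|nlong]; first by rewrite !add0r box_cutoff_le1.
have [[i vi]|small] := pselect (exists i : K.-bseq sign * 'I_L, t + 4 * e < `|block_vec q b (Num.sqrt N%:R) s i|).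
  by rewrite (box_cutoff0 (i := i)) ?addr0 //; move: vi; lra.
exfalso; apply: nHs.
apply: (block_vec_normality_le (t := t + 4 * e) (e := e) _ N0 L0 q0 b0 Kb _ eN) => //; try lra.
- by rewrite LN NL.
- by move=> i; rewrite leNgt; apply/negP => vi; apply: small; exists i.
Qed.

(** By fourth moments, each of the [L.+1 <= 2 * L] intervals, of length at most [2 * N / L],
    contributes [O(L ^- 2)], so the sum is [O(1 / L)]. The constant is [56 = 7 * 2 * 4]. *)
Lemma Pr_oscillates_small K L q b N (e : R) : 0 < e -> (0 < L)%N -> (0 < q)%N -> (0 < N)%N ->
  (L * q * b <= N)%N -> (L * L * q <= N)%N ->
  Pr N (oscillates K L.+1 (q * b) (q * b + L * q) N (e * Num.sqrt N%:R)) <=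
  56 * #|{: K.-bseq sign}|%:R * K%:R ^+ 5 / (e ^+ 4 * L%:R).
Proof.
move=> e0 L0 q0 N0 LN LLN.
have NR : 0 < N%:R :> R by rewrite ltr0n.
have LR : 1 <= L%:R :> R by rewrite ler1n.
apply: le_trans (Pr_oscillates _ e0 _ N0 _) _; first by rewrite addn_gt0 !muln_gt0 L0 q0 orbT.
  by rewrite /= mulnA.
set m : R := (q * b + L * q)%:R; have m0 : 0 <= m by [].
have mL : (m * L%:R) ^+ 2 <= (2 * N%:R) ^+ 2.
  rewrite lerXn2r ?nnegrE ?mulr_ge0 // /m -!natrM ler_nat mulnDl mul2n -addnn.
  by rewrite leq_add // mulnC mulnA.
set B : R := #|_|%:R; have B0 : 0 <= B by [].
have K0 : 0 <= K%:R ^+ 5 :> R by rewrite exprn_ge0.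
have e4 : 0 < e ^+ 4 by rewrite exprn_gt0.
have BK0 : 0 <= 7 * B * K%:R ^+ 5 / (e ^+ 4 * N%:R ^+ 2).
  by rewrite !mulr_ge0 ?invr_ge0 // mulr_ge0 ?exprn_ge0 // ltW.
have L2 : 0 < L%:R ^+ 2 :> R by rewrite exprn_gt0 // ltr0n.
rewrite [leLHS](_ : _ = 7 * B * K%:R ^+ 5 / (e ^+ 4 * N%:R ^+ 2) * (L.+1%:R * m ^+ 2)); last by ring.
rewrite [leRHS](_ : _ = 7 * B * K%:R ^+ 5 / (e ^+ 4 * N%:R ^+ 2) * (8 * N%:R ^+ 2 / L%:R)); last first.
  by field; rewrite !lt0r_neq0 // ltr0n.
rewrite ler_wpM2l // -(ler_pM2r L2) -[leLHS]mulrA -exprMn.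
apply: (@le_trans _ _ (2 * L%:R * (2 * N%:R) ^+ 2)).
  by apply: ler_pM => //; rewrite ?exprn_ge0 ?mulr_ge0 // -natr1; lra.
rewrite le_eqVlt; apply/orP; left; apply/eqP.
by field; rewrite lt0r_neq0 // ltr0n.
Qed.

Lemma cutoff_compare K L (t e eta : R) : (0 < L)%N -> 0 < e -> 0 < eta ->
  exists2 q, (0 < q)%N & exists N0, forall N N', (N0 <= N)%N -> (N0 <= N')%N ->
   `|Ex (L * q * (N %/ (L * q))) (fun s => box_cutoff t e
      (block_vec q (N %/ (L * q)) (Num.sqrt N%:R) s : K.-bseq sign * 'I_L -> R)) -
    Ex (L * q * (N' %/ (L * q))) (fun s => box_cutoff t e
      (block_vec q (N' %/ (L * q)) (Num.sqrt N'%:R) s : K.-bseq sign * 'I_L -> R))| <= eta.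
Proof.
move=> L0 e0 eta0; have [C [A [Q [C0 HF]]]] := smooth2_box (K.-bseq sign * 'I_L)%type t e0.
have [G G0 HG] := covariance_bound R K.
set n : R := #|{: K.-bseq sign * 'I_L}|%:R; have n0 : 0 <= n by [].
pose T : R := 1 + 7 * K%:R ^+ 5 * n ^+ 5.
have T0 : 0 < T by rewrite ltr_pwDl // !mulr_ge0 ?exprn_ge0.
have bound (x : R) : exists2 m : nat, (0 < m)%N & x <= m%:R.
  exists (Num.Def.archi_bound `|x|).+1 => //; rewrite (le_trans (ler_norm _)) //.
  by rewrite (le_trans (ltW (archi_boundP _))) // ler_nat.
have [w w0 wT] := bound (4 * C * T / eta).
(* Taking [r] a multiple of [L] makes the number of blocks [L * q] the square [r * r]; the third
   moments then add up to [r ^ 2 * O(r ^- 3)], which a large [w] makes small. *)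
pose r := (L * w)%N; have r0 : (0 < r)%N by rewrite muln_gt0 L0.
pose q := (w * r)%N; have Lq : (L * q = r * r)%N by rewrite mulnA.
exists q; first by rewrite muln_gt0 w0.
(* With the number of blocks now fixed, the covariance errors are [O(1 / N)]. *)
have [N1 N10 HN1] := bound ((r * r)%:R * (C * (n ^+ 2 * (G * K.+2%:R * 2))) * 2 / eta).
exists (maxn N1 ((r * r) * (K + K)).+1) => N N'; rewrite !geq_max => /andP[N1N KN] /andP[N1N' KN'].
rewrite Lq; set b := (N %/ _)%N; set b' := (N' %/ _)%N.
have rr0 : (0 < r * r)%N by rewrite muln_gt0 r0.
have Kb : (K <= b)%N by rewrite leq_divRL // mulnC (leq_trans _ (ltnW KN)) // leq_mul // leq_addr.
have Kb' : (K <= b')%N by rewrite leq_divRL // mulnC (leq_trans _ (ltnW KN')) // leq_mul // leq_addr.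
have N_gt0 : (0 < N)%N by exact: leq_trans N1N.
have N'_gt0 : (0 < N')%N by exact: leq_trans N1N'.
rewrite -Lq -!walk_block_step.
have rR : 0 < r%:R :> R by rewrite ltr0n.
have kap := block_step_covariance (L := L) q rr0 G0 HG.
apply: le_trans (lindeberg (kap := G * K.+2%:R * (N%:R^-1 + N'%:R^-1)) (tau := T / r%:R ^+ 3) _ _ _ C0 HF _ _ _ _ _) _.
- by move=> l i; apply: Ex_block_step.
- by move=> l i; apply: Ex_block_step.
- by move=> l i i'; apply: kap.
- by move=> l; apply: Ex_norm1_block_step => //; rewrite mulnC leq_divM.
- by move=> l; apply: Ex_norm1_block_step => //; rewrite mulnC leq_divM.
rewrite Lq -/n; have N1R : 0 < N1%:R :> R by rewrite ltr0n.
have inv2 : N%:R^-1 + N'%:R^-1 <= 2 * N1%:R^-1 :> R.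
  rewrite mulr2n mulrDl mul1r; apply: lerD; rewrite lef_pV2 ?posrE ?ltr0n // ler_nat //.
set g : R := (r * r)%:R; have g0 : 0 <= g by [].
have H1 : g * (C * (n ^+ 2 * (G * K.+2%:R * (N%:R^-1 + N'%:R^-1)))) <= eta / 2.
  apply: (@le_trans _ _ (g * (C * (n ^+ 2 * (G * K.+2%:R * (2 * N1%:R^-1)))))).
    do 3![rewrite ler_wpM2l ?exprn_ge0 //].
    by rewrite ler_wpM2l // mulr_ge0.
  move: HN1; rewrite ler_pdivrMr // => HN1.
  rewrite [leLHS](_ : _ = g * (C * (n ^+ 2 * (G * K.+2%:R * 2))) / N1%:R); last by ring.
  by rewrite ler_pdivrMr //; move: HN1; rewrite -/g; lra.
have H2 : g * (C * (2 * (T / r%:R ^+ 3))) <= eta / 2.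
  rewrite [leLHS](_ : _ = 2 * C * T / r%:R); last by rewrite /g natrM; field; rewrite lt0r_neq0.
  rewrite ler_pdivrMr //; move: wT; rewrite ler_pdivrMr // => wT.
  have wr : w%:R * eta <= r%:R * eta by rewrite ler_wpM2r ?(ltW eta0) // ler_nat /r leq_pmull.
  by lra.
by rewrite mulrDr mulrDr; lra.
Qed.

(** The order of the choices matters: [K] discards long patterns, [L] depends on [K] through the
    oscillation bound, [q] on both through the replacement error, and the threshold on [N] comes
    last. *)
Lemma normality_cdf_compare (t eps eta : R) : 0 <= t -> 0 < eps -> 0 < eta ->
  exists N0, forall N N', (N0 <= N)%N -> (N0 <= N')%N ->
  normality_cdf N t <= normality_cdf N' (t + eps) + eta.
Proof.
move=> t0 eps0 eta0; pose e := eps / 8; have e0 : 0 < e by rewrite divr_gt0.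
have epsE : eps = 8 * e by rewrite /e; field.
have eta4 : 0 < eta / 4 by lra.
have [K HK] := long_patterns_negligible eps0 eta4.
set B : R := 56 * #|{: K.-bseq sign}|%:R * K%:R ^+ 5 / e ^+ 4.
have [L L0 HL] : exists2 L, (0 < L)%N & B / (eta / 4) <= L%:R.
  exists (Num.Def.archi_bound `|B / (eta / 4)|).+1 => //; rewrite (le_trans (ler_norm _)) //.
  by rewrite (le_trans (ltW (archi_boundP _))) // ler_nat.
have LR : 0 < L%:R :> R by rewrite ltr0n.
have [q q0 [N0 HN0]] := cutoff_compare K (t + e) L0 e0 eta4.
have [n1 Hn1] := sqrt_nat_large ((L * q * K + K)%:R / e).
exists (maxn N0 (maxn n1 (maxn (2 ^ K) (maxn (L * q * K.+1) (L * L * q))))) => N N'.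
rewrite !geq_max => /andP[N0N /and4P[n1N KN LN LLN]] /andP[N0N' /and4P[n1N' KN' LN' LLN']].
have Lq0 : (0 < L * q)%N by rewrite muln_gt0 L0.
have Kb : (K < N %/ (L * q))%N by rewrite leq_divRL // mulnC.
have Kb' : (K < N' %/ (L * q))%N by rewrite leq_divRL // mulnC.
have N_gt0 : (0 < N)%N by rewrite (leq_trans _ KN) // expn_gt0.
have N'_gt0 : (0 < N')%N by rewrite (leq_trans _ KN') // expn_gt0.
have eN : (L * q * K + K)%:R <= e * Num.sqrt N%:R by rewrite mulrC -ler_pdivrMr // Hn1.
have eN' : (L * q * K + K)%:R <= e * Num.sqrt N'%:R by rewrite mulrC -ler_pdivrMr // Hn1.
apply: le_trans (normality_cdf_le_cutoff t0 e0 N_gt0 KN q0 (ltnW Kb) eN) _.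
have h1 := HN0 N N' N0N N0N'.
have eN'' : (L * q * K)%:R <= e * Num.sqrt N'%:R by rewrite (le_trans _ eN') // ler_nat leq_addr.
have h2 := cutoff_le_normality_cdf t0 e0 N'_gt0 L0 q0 (leq_ltn_trans (leq0n K) Kb') (ltnW Kb') eN''.
have h3 : Pr N' (long_pattern_deviates K N' ((t + 8 * e) * Num.sqrt N'%:R)) <= eta / 4.
  apply: le_trans (HK _ N'_gt0); apply: le_Pr => s _ [X [M [a1 a2 a3 a4]]].
  exists X, M; split=> //; apply: le_lt_trans a4.
  by rewrite ler_wpM2r ?sqrtr_ge0 //; lra.
have LN'' : (L * q * (N' %/ (L * q)) <= N')%N by rewrite mulnC leq_divM.
have h4 := Pr_oscillates_small K e0 L0 q0 N'_gt0 LN'' LLN'.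
have h5 : 56 * #|{: K.-bseq sign}|%:R * K%:R ^+ 5 / (e ^+ 4 * L%:R) <= eta / 4.
  rewrite invfM mulrA -/B ler_pdivrMr // mulrC -ler_pdivrMr //.
move: h1; rewrite ler_norml => /andP[_ h1]; rewrite epsE.
by lra.
Qed.

End Comparison.

(** * The limit law *)

Section LimitLaw.
Variable R : realType.
Implicit Types (X : seq sign).
Local Notation Pr := (Pr R).
Local Open Scope classical_set_scope.

(** The jump estimate links only a fixed length [M] with some [M' >= M]. Comparing [N] with [M']
    above [t], and [M] with [N'] below [t], extends it to all large lengths; each of the three links
    costs [eta / 3]. *)
Lemma normality_cdf_key (t eta : R) : 0 < eta ->
  exists2 rho : R, 0 < rho & exists N0, forall N N', (N0 <= N)%N -> (N0 <= N')%N ->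
    normality_cdf N (t + rho) <= normality_cdf N' (t - rho) + eta.
Proof.
move=> eta0; have eta3 : 0 < eta / 3 by lra.
have compare (x eps : R) : 0 < eps -> exists N0, forall N N', (N0 <= N)%N -> (N0 <= N')%N ->
    normality_cdf N x <= normality_cdf N' (x + eps) + eta / 3.
  move=> eps0; have [x0|x0] := leP 0 x; first exact: normality_cdf_compare.
  exists 2 => N N' N2 _; rewrite normality_cdf_lt0 // addr_ge0 ?(ltW eta3) //.
  exact: Pr_ge0.
have [z [y [zt ty [N1 jump]]]] := normality_cdf_jump t eta3.
pose rho := Num.min ((y - t) / 2) ((t - z) / 2).
have rho0 : 0 < rho by rewrite lt_min; apply/andP; split; lra.
have rhoy : t + rho + rho <= y.
  by have : rho <= (y - t) / 2 by [rewrite ge_min lexx]; lra.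
have rhoz : z + rho <= t - rho.
  by have : rho <= (t - z) / 2 by [rewrite ge_min lexx orbT]; lra.
have [N2 c2] := compare (t + rho) rho rho0; have [N3 c3] := compare z rho rho0.
exists rho => //; exists (maxn N1 (maxn N2 N3)) => N N'.
rewrite !geq_max => /and3P[N1N N2N N3N] /and3P[N1N' N2N' N3N'].
pose M := maxn N1 (maxn N2 N3).
have [M' MM' jM] := jump M (leq_maxl _ _).
have M2 : (N2 <= M)%N by rewrite /M maxnCA leq_maxl.
have M3 : (N3 <= M)%N by rewrite /M maxnA leq_maxr.
have h1 := c2 N M' N2N (leq_trans M2 MM').
have h2 := c3 M N' M3 N3N'.
have h3 := normality_cdf_mono M' rhoy; have h4 := normality_cdf_mono N' rhoz.
by lra.
Qed.

(** By monotonicity, [normality_cdf_key] confines the values at [t] for all large lengths to an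
    interval of width [e / 2], hence the Cauchy property. *)
Lemma normality_cdf_cvg (t : R) : cvg (normality_cdf N t @[N --> \oo]).
Proof.
apply/cauchy_cvgP/cauchy_exP => e e0.
have e2 : 0 < e / 2 by rewrite divr_gt0.
have [rho rho0 [N0 H]] := normality_cdf_key t e2.
exists (normality_cdf N0 t); exists N0 => // N /= N0N; rewrite /ball /=.
have tl : t - rho <= t by lra.
have tr : t <= t + rho by lra.
have h1 := H N0 N (leqnn _) N0N; have h2 := H N N0 N0N (leqnn _).
have := normality_cdf_mono N tl; have := normality_cdf_mono N tr.
have := normality_cdf_mono N0 tl; have := normality_cdf_mono N0 tr.
by move=> *; rewrite ltr_norml; apply/andP; split; lra.
Qed.

Definition normality_limit_cdf (t : R) : R := lim (normality_cdf N t @[N --> \oo]).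

Local Notation F := normality_limit_cdf.

Lemma normality_limit_cdf_nondecreasing : nondecreasing F.
Proof.
move=> t t' tt'; apply: ler_lim; [exact: normality_cdf_cvg | exact: normality_cdf_cvg |].
by near=> N; apply: normality_cdf_mono.
Unshelve. all: by end_near. Qed.

Lemma normality_limit_cdf_key (t eta : R) : 0 < eta ->
  exists2 rho : R, 0 < rho & F (t + rho) <= F (t - rho) + eta.
Proof.
move=> eta0; have [rho rho0 [N0 H]] := normality_cdf_key t eta0.
exists rho => //; rewrite -lerBlDr; apply: limr_ge; first exact: normality_cdf_cvg.
near=> N'; rewrite lerBlDr; apply: limr_le; first exact: normality_cdf_cvg.
near=> N; apply: H; [near: N | near: N']; exact: nbhs_infty_ge.
Unshelve. all: by end_near. Qed.

Lemma normality_limit_cdf_continuous : continuous F.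
Proof.
move=> t; apply/cvgrPdist_le => e e0.
have [rho rho0 H] := normality_limit_cdf_key t e0.
near=> s.
have st : `|t - s| <= rho by near: s; apply: cvgr_dist_le => //; exact: cvg_id.
have Fm := normality_limit_cdf_nondecreasing.
have h1 : F (t - rho) <= F s by apply: Fm; move: st; rewrite ler_norml => /andP[? ?]; lra.
have h2 : F s <= F (t + rho) by apply: Fm; move: st; rewrite ler_norml => /andP[? ?]; lra.
have h3 : F (t - rho) <= F t by apply: Fm; lra.
have h4 : F t <= F (t + rho) by apply: Fm; lra.
by rewrite ler_norml; apply/andP; split; lra.
Unshelve. all: by end_near. Qed.

Lemma normality_limit_cdf_lt0 (t : R) : t < 0 -> F t = 0.
Proof.
move=> t0; apply: cvg_lim => //; apply: cvg_near_cst.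
by near=> N; apply: normality_cdf_lt0 => //; near: N; exact: nbhs_infty_ge.
Unshelve. all: by end_near. Qed.

Lemma normality_limit_cdf_le1 (t : R) : F t <= 1.
Proof.
apply: limr_le; first exact: normality_cdf_cvg.
by near=> N; exact: Pr_le1.
Unshelve. all: by end_near. Qed.

(** Tightness: for [K = 0] every nonempty pattern is long, so [Pr_long_patterns] bounds the tail of
    the whole measure. *)
Lemma normality_limit_cdf_ge : exists2 C : R, 0 <= C & forall t, 1 <= t -> 1 - C / t <= F t.
Proof.
have [C C0 H] := Pr_long_patterns R; exists C => // t t1.
have t0 : 0 < t by lra.
apply: limr_ge; first exact: normality_cdf_cvg.
near=> N; have N0 : (0 < N)%N by near: N; exact: nbhs_infty_gt.
rewrite lerBlDr addrC -lerBlDr -PrC.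
apply: (@le_trans _ _ (C / t ^+ 4 * (3 / 4) ^+ 0)).
  apply: le_trans (H t 0%N N t0 N0); apply: le_Pr => s _ Hs.
  apply: contrapT => nlong; apply: Hs => X M X0 XN MN; rewrite leNgt; apply/negP => XM.
  by apply: nlong; exists X, M.
rewrite expr0 mulr1 ler_wpM2l // lef_pV2 ?posrE ?exprn_gt0 //.
by rewrite ler_eXnr.
Unshelve. all: by end_near. Qed.

Lemma normality_limit_cdf_cvgNy : F @ -oo --> (0 : R).
Proof.
apply: cvg_near_cst; exists 0; split=> // t t0.
exact: normality_limit_cdf_lt0.
Qed.

Lemma normality_limit_cdf_cvgy : F @ +oo --> (1 : R).
Proof.
have [C C0 H] := normality_limit_cdf_ge.
apply/cvgrPdist_le => e e0; exists (1 + C / e); split; first exact: num_real.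
move=> t tC; have Ce : 0 <= C / e by rewrite divr_ge0 // ltW.
have t1 : 1 <= t by lra.
rewrite ger0_norm ?subr_ge0 ?normality_limit_cdf_le1 //.
have Ct : C / t <= e.
  have : C / e <= t by lra.
  by rewrite ler_pdivrMr // mulrC -ler_pdivrMr //; lra.
by have := H t t1; lra.
Qed.

HB.instance Definition _ := isCumulative.Build R _ R F
  normality_limit_cdf_nondecreasing
  (fun t => right_continuousW normality_limit_cdf_continuous (x := t)).

HB.instance Definition _ := isCumulativeBounded.Build R 0 1 F
  normality_limit_cdf_cvgNy normality_limit_cdf_cvgy.

End LimitLaw.

(** * Transfer from expectations on sequences to random elements of a probability space *)

Section Bridge.
Variable R : realType.
Local Open Scope classical_set_scope.

Lemma uniformly_distributed_pred (d : measure_display) (Omega : measurableType d)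
    (P : probability Omega R) (S : finType) (E : Omega -> S) (A : pred S) :
  uniformly_distributed P E ->
  P [set w | A (E w)] = ((\sum_(s : S) (A s)%:R) / #|S|%:R)%:E.
Proof.
move=> U.
have H (r : seq S) : uniq r -> measurable [set w | E w \in r] /\
   P [set w | E w \in r] = ((size r)%:R / #|S|%:R)%:E.
  elim: r => [_|a r IH /= /andP[ar ur]].
    have -> : [set w | E w \in [::]] = set0 by apply/seteqP; split.
    by rewrite measure0 mul0r; split.
  have [mr Pr_r] := IH ur; have [ma Pr_a] := U a.
  have -> : [set w | E w \in a :: r] = (E @^-1` [set a]) `|` [set w | E w \in r].
    apply/seteqP; split=> w /=; rewrite in_cons.
      by case/orP => [/eqP|]; [left|right].
    by case=> [->|->]; rewrite ?eqxx ?orbT.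
  split; first exact: measurableU.
  rewrite measureU //; last first.
    by apply/seteqP; split=> // w /= [-> ra]; move: ar; rewrite ra.
  by rewrite [X in (X + _)%E]Pr_a [X in (_ + X)%E]Pr_r -EFinD -[(size r).+1%:R]natr1 mulrDl mul1r addrC.
have [_] := H _ (enum_uniq A).
have -> : [set w | E w \in enum A] = [set w | A (E w)].
  by apply/seteqP; split=> w /=; rewrite mem_enum.
move=> ->; congr (_ / _)%:E; rewrite -cardE -sum1_card natr_sum big_mkcond /=.
by apply: eq_bigr => s _; rewrite unfold_in; case: (A s).
Qed.

Lemma bigmax0_leP (I : eqType) (r : seq I) (f : I -> R) (y : R) :
  \big[Num.max/0]_(i <- r) f i <= y <-> 0 <= y /\ forall i, i \in r -> f i <= y.
Proof.
elim: r => [|i r IH]; first by rewrite big_nil; split=> [->|[]].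
rewrite big_cons ge_max; split=> [/andP[fi /IH[y0 fr]]|[y0 fr]].
  by split=> // j; rewrite in_cons => /orP[/eqP -> //|/fr].
rewrite fr ?mem_head //; apply/IH; split=> // j jr.
by apply: fr; rewrite in_cons jr orbT.
Qed.

Lemma pattern_countE N k (s : N.-tuple sign) M (X : k.-tuple sign) :
  (pattern_count s M X)%:R - M%:R / 2 ^+ k = disc R X s M.
Proof.
rewrite /pattern_count -sum1_card natr_sum big_mkcond /= /disc sumrB.
congr (_ - _); last by rewrite sumr_const card_ord mulr_natl /prob size_tuple.
by apply: eq_bigr => i _; rewrite size_tuple unfold_in /=; case: (_ == _).
Qed.

(** The neutral element 0 of the maxima imposes [0 <= y]; on the other side this comes from [M = 0]
    and a pattern of length one, which is admissible only for [2 <= N]. *)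
Lemma normality_measure_leP N (s : N.-tuple sign) (y : R) : (2 <= N)%N ->
  (normality_measure R s <= y) <-> normality_le N y s.
Proof.
move=> N2; have N0 : (0 < N)%N by rewrite (leq_trans _ N2).
have mem1 k n : (k \in index_iota 1 n.+1) = (0 < k <= n)%N by rewrite mem_index_iota ltnS.
rewrite /normality_measure; split.
  move=> /bigmax0_leP[y0 H] X M X0 XN MN.
  have kN : (size X <= trunc_log 2 N)%N by apply: trunc_log_max.
  have [M0|M0] := posnP M; first by rewrite M0 disc0 normr0.
  have /bigmax0_leP[_ H'] := H (size X) (etrans (mem1 _ _) (introT andP (conj X0 kN))).
  have /bigmax0_leP[_ H''] := H' (in_tuple X) (mem_index_enum _).
  have := H'' M; rewrite mem1 M0 /= pattern_countE; apply.
  by rewrite addn1 leq_subRL 1?addnC // (leq_trans _ MN) // leq_addl.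
move=> H; have y0 := normality_le_ge0 N2 H.
apply/bigmax0_leP; split=> // k; rewrite mem1 => /andP[k0 kN].
have kN2 : (2 ^ k <= N)%N by rewrite (leq_trans _ (trunc_logP (ltnSn 1) N0)) // leq_exp2l.
apply/bigmax0_leP; split=> // X _; apply/bigmax0_leP; split=> // M.
rewrite mem1 => /andP[M0 MN]; rewrite pattern_countE; apply: H; rewrite size_tuple //.
by have := ltn_expl k (ltnSn 1); lia.
Qed.

Lemma uniform_normality_cdf (d : measure_display) (Omega : measurableType d)
    (P : probability Omega R) N (E : Omega -> N.-tuple sign) (t : R) : (2 <= N)%N ->
  uniformly_distributed P E ->
  P [set w | normality_measure R (E w) / Num.sqrt N%:R <= t] = (normality_cdf N t)%:E.
Proof.
move=> N2 U; rewrite (uniformly_distributed_pred (fun s => normality_measure R s / Num.sqrt N%:R <= t) U).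
rewrite /normality_cdf /Pr Ex_tuple card_tuple card_sign natrX; congr (_ / _)%:E.
apply: eq_bigr => s _; congr (nat_of_bool _)%:R.
rewrite ler_pdivrMr ?sqrtr_gt0 ?ltr0n 1?(leq_trans _ N2) //.
by apply/idP/asboolP => /normality_measure_leP; apply.
Qed.

End Bridge.

Local Open Scope classical_set_scope.
Local Open Scope ring_scope.

Theorem theorem1 (R : realType)
    (d : nat -> measure_display)
    (Omega : forall N : nat, measurableType (d N))
    (P : forall N : nat, probability (Omega N) R)
    (E : forall N : nat, Omega N -> N.-tuple sign)
    (E_uniform : forall N : nat, (1 <= N)%N ->
       uniformly_distributed (P N) (E N)) :
  exists F : cumulativeBounded (0 : R) (1 : R),
    (forall t : R,
       P N [set w | normality_measure R (E N w) / Num.sqrt N%:R <= t]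
         @[N --> \oo] --> (F t)%:E) /\
    continuous F.
Proof.
exists (@normality_limit_cdf R : cumulativeBounded (0 : R) (1 : R)).
split; last exact: normality_limit_cdf_continuous.
move=> t; have lim_t : (normality_cdf N t)%:E @[N --> \oo] --> (normality_limit_cdf t)%:E.
  by apply: cvg_EFin; [near=> N | exact: normality_cdf_cvg].
apply: cvg_trans lim_t; apply: near_eq_cvg; near=> N.
have N2 : (2 <= N)%N by near: N; exact: nbhs_infty_ge.
by rewrite uniform_normality_cdf //; apply: E_uniform; exact: leq_trans N2.
Unshelve. all: by end_near. Qed.
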